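(* Let $n\ge 1$, let $\alpha_j,p_j,\beta_j,q_j,w_j^{(1)},w_j^{(2)}>0$ for $1\le j\le n$, and let $X_1,\dots,X_n,Y_1,\dots,Y_n$ be independent random variables with $X_j\sim Ga(\alpha_j,p_j)$ and $Y_j\sim Ga(\beta_j,q_j)$. Put $$T_n=\sum_{j=1}^n\big(w_j^{(1)}X_j-w_j^{(2)}Y_j\big),\qquad p=\sum_{j=1}^n p_j,\qquad q=\sum_{j=1}^n q_j,$$ $$\alpha=\max_{1\le j\le n}\frac{\alpha_j}{w_j^{(1)}+\alpha_j},\qquad \beta=\max_{1\le j\le n}\frac{\beta_j}{w_j^{(2)}+\beta_j}.$$ Then $$T_n\sim BG\Big(\frac{\alpha}{1-\alpha},\,L_n+p,\,\frac{\beta}{1-\beta},\,M_n+q\Big),$$ where $L_n$ and $M_n$ are the independent $\{0,1,2,\dots\}$-valued random variables whose distributions are given in the context, and the right-hand side denotes the corresponding mixture of bilateral gamma distributions.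
   Context: $Ga(a,s)$ ($a,s>0$) is the gamma distribution with rate $a$ and shape $s$, i.e. with characteristic function $z\mapsto(1-iz/a)^{-s}$. For $a,s,b,t>0$, $BG(a,s,b,t)$ (bilateral gamma) is the distribution of $U-V$ with $U\sim Ga(a,s)$, $V\sim Ga(b,t)$ independent; its characteristic function is $(1-iz/a)^{-s}(1+iz/b)^{-t}$. For independent $\{0,1,2,\dots\}$-valued random variables $L,M$ and $a,b,p,q>0$, ''$T\sim BG(a,L+p,b,M+q)$'' means that the law of $T$ is the mixture of the laws $BG(a,p+j,b,q+k)$ with weights $P(L=j)P(M=k)$, i.e. $$\mathbb{E}(e^{izT})=\sum_{j=0}^\infty\sum_{k=0}^\infty \frac{P(L=j)P(M=k)}{(1-iz/a)^{p+j}(1+iz/b)^{q+k}},\quad z\in\mathbb{R}.$$ Distributions of $L_n$ and $M_n$: set $$c_n=\prod_{j=1}^n\Big(\frac{(1-\alpha)\alpha_j}{w_j^{(1)}\alpha}\Big)^{p_j},\qquad d_n=\prod_{j=1}^n\Big(\frac{(1-\beta)\beta_j}{w_j^{(2)}\beta}\Big)^{q_j},$$ $$a_i=\frac1i\sum_{j=1}^n p_j\Big(1-\frac{(1-\alpha)\alpha_j}{w_j^{(1)}\alpha}\Big)^i,\qquad b_i=\frac1i\sum_{j=1}^n q_j\Big(1-\frac{(1-\beta)\beta_j}{w_j^{(2)}\beta}\Big)^i,\quad i\ge1,$$ $\gamma_0=\delta_0=1$, and $\gamma_k=\frac1k\sum_{i=1}^k i\,a_i\gamma_{k-i}$, $\delta_k=\frac1k\sum_{i=1}^k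 i\,b_i\delta_{k-i}$ for $k\ge1$. Then $P(L_n=k)=c_n\gamma_k$ and $P(M_n=k)=d_n\delta_k$ for $k\ge0$. *)

(* Defs.v *)
From HB Require Import structures.
From mathcomp Require Import all_boot all_order all_algebra.
From mathcomp Require Import all_classical all_reals all_analysis.

Set Implicit Arguments.
Unset Strict Implicit.
Unset Printing Implicit Defensive.

Import Order.TTheory GRing.Theory Num.Theory.
Import numFieldNormedType.Exports.

Local Open Scope classical_set_scope.
Local Open Scope ring_scope.

Definition gamma_fun {R : realType} (s : R) : R :=
  \int[lebesgue_measure]_(x in `]0, +oo[) (x `^ (s - 1) * expR (- x)).

(* [a] is the rate and [s] the shape. *)
Definition gamma_pdf {R : realType} (a s : R) : R -> R :=
  (fun x => a `^ s / gamma_fun s * (x `^ (s - 1) * expR (- a * x)))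
    \_ `]0, +oo[.

(* As for [exponential_prob], a plain set function, which is a probability
   measure only when both parameters are positive. *)
Definition gamma_prob {R : realType} (a s : R) : set R -> \bar R :=
  fun A => (\int[lebesgue_measure]_(x in A) (gamma_pdf a s x)%:E)%E.

Definition bilateral_gamma_prob {R : realType} (a s b t : R) :
    set R -> \bar R :=
  pushforward (gamma_prob a s \x gamma_prob b t)%E
    (fun uv : R * R => uv.1 - uv.2).

Section laws.
Local Open Scope ereal_scope.
Context {d d' : measure_display} {T : measurableType d}
  {T' : measurableType d'} {R : realType} (P : probability T R).

(* Restricted to measurable sets: set functions that agree there may differ
   elsewhere. *)
Definition has_law (X : T -> T') (nu : set T' -> \bar R) : Prop :=
  forall A : set T', measurable A -> pushforward P X A = nu A.

Definition mutually_independent (I : finType) (X : I -> {RV P >-> T'}) : Prop :=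
  forall (J : {set I}) (B : I -> set T'),
    (forall i, i \in J -> measurable (B i)) ->
    P (\bigcap_(i in [set` J]) (X i @^-1` B i)) =
    \prod_(i in J) P (X i @^-1` B i).

End laws.

(* The mixture of the laws BG(a, p + j, b, q + k) with weights
   Q(L = j) Q(M = k), written BG(a, L + p, b, M + q) for independent L, M. *)
Definition bilateral_gamma_mixture {d : measure_display}
    {T : measurableType d} {R : realType} (Q : probability T R) (a : R)
    (L : {RV Q >-> nat}) (p b : R) (M : {RV Q >-> nat}) (q : R) :
    set R -> \bar R :=
  fun A => (\sum_(0 <= j <oo) \sum_(0 <= k <oo)
    Q (L @^-1` [set j]) * Q (M @^-1` [set k]) *
    bilateral_gamma_prob a (p + j%:R) b (q + k%:R) A)%E.

Section recursive_coefficients.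
Context {R : realType} (a : nat -> R).

Fixpoint rec_coefs (k : nat) : seq R :=
  if k is k'.+1 then
    let s := rec_coefs k' in
    rcons s (k%:R^-1 * \sum_(1 <= i < k.+1) i%:R * a i * s`_(k - i))
  else [:: 1].

Definition rec_coef (k : nat) : R := (rec_coefs k)`_k.

Lemma size_rec_coefs k : size (rec_coefs k) = k.+1.
Proof. by elim: k => //= k IH; rewrite size_rcons IH. Qed.

Lemma nth_rec_coefs k i : (i <= k)%N -> (rec_coefs k)`_i = rec_coef i.
Proof.
elim: k => [|k IH]; first by rewrite leqn0 => /eqP ->.
rewrite leq_eqVlt => /predU1P[-> //|]; rewrite ltnS => ik.
by rewrite /= nth_rcons size_rec_coefs ltnS ik IH.
Qed.

Lemma rec_coef0 : rec_coef 0 = 1.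
Proof. by []. Qed.

Lemma rec_coefE k : (0 < k)%N ->
  rec_coef k = k%:R^-1 * \sum_(1 <= i < k.+1) i%:R * a i * rec_coef (k - i).
Proof.
case: k => // k _; rewrite {1}/rec_coef /= nth_rcons size_rec_coefs ltnn eqxx.
congr (_ * _); apply: eq_big_nat => i /andP[i1 _].
by rewrite nth_rec_coefs// leq_subLR -add1n leq_add2r.
Qed.

End recursive_coefficients.

(* The rates [alpha], shapes [p] and weights [w] of one of the two families
   (X_j) and (Y_j); the same formulas serve for both. *)
Section weights.
Context {R : realType} (n : nat) (alpha p w : 'I_n -> R).

(* The base value 0 is harmless: the terms are positive and n >= 1. *)
Definition max_ratio : R :=
  \big[Num.max/0]_(j < n) (alpha j / (w j + alpha j)).

Definition scale_ratio (j : 'I_n) : R :=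
  (1 - max_ratio) * alpha j / (w j * max_ratio).

Definition mix_const : R := \prod_(j < n) scale_ratio j `^ p j.

Definition mix_exponent (i : nat) : R :=
  i%:R^-1 * \sum_(j < n) p j * (1 - scale_ratio j) ^+ i.

Definition mix_pmf (k : nat) : R := mix_const * rec_coef mix_exponent k.

End weights.

(* Main.v *)
From HB Require Import structures.
Require Import Defs.
From mathcomp Require Import all_boot all_order all_algebra.
From mathcomp Require Import all_classical all_reals all_analysis.
From mathcomp Require Import measurable_realfun.
From mathcomp Require Import ring lra.

(** With [theta_j = alpha_j / w_j], the variable [w_j X_j] has law
    [Ga(theta_j, p_j)]. As [t |-> t / (1 + t)] increases,
    [a = alpha / (1 - alpha)] is the largest of the [theta_j], so that
    [theta_j = r_j a] with [r_j = scale_ratio j] and [0 < r_j <= 1]. The law of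
    [sum_j w_j X_j] is then found as follows.

    - A gamma law of rate [r a] is a mixture of gamma laws of the larger rate
      [a]: in the density, [e^(-r a x) = e^(-a x) e^((1-r) a x)], and expanding
      the second exponential in powers of [x] gives the laws [Ga(a, p + k)] with
      negative binomial weights ([gamma_law_negbin]).
    - Gamma laws of the same rate convolve by adding their shapes
      ([gamma_law_conv]). Hence [sum_j w_j X_j] is a mixture of laws
      [Ga(a, p + k)], whose weights are the convolution of the [n] negative
      binomial distributions ([law_sum_gamma]).
    - This convolution is [mix_pmf]. The sequence [rec_coef b] consists of the
      coefficients of [exp (sum_i b_i z^i)], so that adding exponents multiplies
      the series ([rec_coefD]), and the negative binomial distribution is the
      case [b_i = p (1 - r)^i / i], up to the factor [r^p].

    Evaluating on the whole line shows that the weights have sum [1]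
    ([nbsum_pmf_total]), so that [L_n] and [M_n] exist. The two sums are
    independent ([law_of_disjoint_sums]); the law of their difference is the
    image of a product of two mixtures, that is, a double mixture of bilateral
    gamma laws ([product_mixture]).

    Laws are compared through their densities. The Beta integral that appears in
    the convolution of two gamma densities is determined by the total mass. The
    Gamma function enters through its functional equation ([gamma_mass_rec]), on
    which the negative binomial weights depend, and through its finiteness and
    positivity. *)

Set Implicit Arguments.
Unset Strict Implicit.
Unset Printing Implicit Defensive.

Import Order.TTheory GRing.Theory Num.Theory.
Import numFieldNormedType.Exports.

Local Open Scope classical_set_scope.
Local Open Scope ring_scope.

(** * Coefficients of exponentials of power series *)
Section recursive_coefficients.
Context {R : realType}.
Implicit Types a b : nat -> R.

Lemma rec_coef_mulrn a k : (0 < k)%N ->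
  k%:R * rec_coef a k = \sum_(i < k) i.+1%:R * a i.+1 * rec_coef a (k - i.+1).
Proof.
move=> k0; rewrite rec_coefE// mulrA divff ?mul1r ?pnatr_eq0 -?lt0n//.
by rewrite big_add1 /= big_mkord.
Qed.

(** The recursion determines each coefficient from the previous ones; every
    identification of a sequence with a [rec_coef] below goes through this. *)
Lemma rec_coef_uniq a (c : nat -> R) : c 0%N = 1 ->
  (forall k, (0 < k)%N ->
    k%:R * c k = \sum_(i < k) i.+1%:R * a i.+1 * c (k - i.+1)%N) ->
  forall k, c k = rec_coef a k.
Proof.
move=> c0 cE k; have [m] := ubnP k; elim: m k => // m IH [|k] km.
  by rewrite c0 rec_coef0.
apply: (@mulfI _ k.+1%:R); first by rewrite pnatr_eq0.
rewrite cE// rec_coef_mulrn//; apply: eq_bigr => i _; rewrite IH//.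
by rewrite subSS (leq_ltn_trans (leq_subr _ _)).
Qed.

Lemma rec_coef_ge0 a k : (forall i, (0 < i)%N -> 0 <= a i) -> 0 <= rec_coef a k.
Proof.
move=> a0; have [m] := ubnP k; elim: m k => // m IH [|k] km.
  by rewrite rec_coef0.
rewrite rec_coefE// mulr_ge0// big_add1 /= big_mkord sumr_ge0// => i _.
by rewrite mulr_ge0 ?mulr_ge0 ?a0// IH// subSS (leq_ltn_trans (leq_subr _ _)).
Qed.

Lemma rec_coef_eq a b k : (forall i, (0 < i)%N -> a i = b i) ->
  rec_coef a k = rec_coef b k.
Proof.
move=> ab; apply: rec_coef_uniq => // {}k k0.
by rewrite rec_coef_mulrn//; apply: eq_bigr => i _; rewrite ab.
Qed.

Lemma rec_coef_zero k : rec_coef (fun=> 0 : R) k = (k == 0%N)%:R.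
Proof.
apply/esym/(@rec_coef_uniq _ (fun k => (k == 0%N)%:R)) => // -[//|{}k] _.
by rewrite /= mulr0 big1// => i _; rewrite mulr0 mul0r.
Qed.

(** The series [U] with coefficients [rec_coef a] is the exponential of
    [sum_i a_i z^i], and its recursion is the differential equation
    [z U' = A U] with [A = sum_i i a_i z^i]. If also [z V' = B V], then
    [z (U V)' = (A + B) (U V)]. The coefficient of index [m <= k] only involves
    coefficients of index at most [k], so polynomials truncated at degree [k]
    can replace the series. *)
Lemma rec_coefD a b k :
  \sum_(i < k.+1) rec_coef a i * rec_coef b (k - i) =
  rec_coef (fun i => a i + b i) k.
Proof.
pose U := \poly_(i < k.+1) rec_coef a i.
pose V := \poly_(i < k.+1) rec_coef b i.
pose A c : {poly R} := \poly_(i < k.+1) (i%:R * c i).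
have XderE c m (mk : (m <= k)%N) :
    ('X * (\poly_(i < k.+1) rec_coef c i)^`())`_m =
    (A c * \poly_(i < k.+1) rec_coef c i)`_m.
  rewrite coefXM coefM; case: m mk => [|m] mk /=.
    by rewrite big_ord1 [X in X * _]coef_poly/= !mul0r.
  rewrite coef_deriv [X in X *+ _]coef_poly ltnS mk -mulr_natl rec_coef_mulrn//.
  rewrite [RHS]big_ord_recl [X in _ = X * _ + _]coef_poly/= !mul0r add0r.
  apply: eq_bigr => i _.
  rewrite /bump/= add1n subSS !coef_poly !ltnS (leq_trans (ltn_ord i) mk).
  by rewrite (leq_trans (leq_subr _ _) (ltnW mk)).
have UVE m : (m <= k)%N -> (U * V)`_m = rec_coef (fun i => a i + b i) m.
  have [l] := ubnP m; elim: l m => // l IH [|m] ml mk.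
    by rewrite coefM big_ord1 !coef_poly/= !rec_coef0 mulr1.
  apply: (@mulfI _ m.+1%:R); first by rewrite pnatr_eq0.
  rewrite mulr_natl -coef_deriv -[LHS](coefXM (_^`()) m.+1) derivM mulrDr.
  rewrite mulrA [in X in _ + X]mulrCA coefD !coefM.
  under eq_bigr => i _ do rewrite XderE ?(leq_trans _ mk)// -1?ltnS//.
  under [X in _ + X]eq_bigr => i _ do
    rewrite XderE ?(leq_trans (leq_subr _ _) mk)//.
  rewrite -!coefM -/U -/V mulrCA -mulrA -coefD -mulrDl coefM big_ord_recl/=.
  rewrite coefD !coef_poly/= !mul0r addr0 mul0r add0r rec_coef_mulrn//.
  apply: eq_bigr => i _; rewrite coefD !coef_poly /bump/= add1n ltnS.
  rewrite (leq_trans (ltn_ord i) mk).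
  rewrite -mulrDr IH//; first by rewrite subSS (leq_ltn_trans (leq_subr _ _)).
  exact: leq_trans (leq_subr _ _) mk.
rewrite -(UVE k)// coefM; apply: eq_bigr => i _; rewrite !coef_poly.
by rewrite ltn_ord ltnS leq_subr.
Qed.

(** For the exponents [p x^i / i] the series is [(1 - x z)^(-p)], whose
    coefficients satisfy a two-term recursion: all the summands but the first
    are [x] times those of the previous step. *)
Lemma rec_coef_geom (p x : R) k :
  k.+1%:R * rec_coef (fun i => i%:R^-1 * (p * x ^+ i)) k.+1 =
  x * (p + k%:R) * rec_coef (fun i => i%:R^-1 * (p * x ^+ i)) k.
Proof.
set u := rec_coef _.
have uE m : (0 < m)%N ->
    m%:R * u m = \sum_(i < m) p * x ^+ i.+1 * u (m - i.+1)%N.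
  move=> m0; rewrite /u rec_coef_mulrn//; apply: eq_bigr => i _.
  by rewrite !mulrA divff ?mul1r// pnatr_eq0.
rewrite uE// big_ord_recl/= subn1/= expr1.
rewrite [X in _ + X](_ : _ = x * (k%:R * u k)); first by ring.
case: k => [|k]; first by rewrite big_ord0 mul0r mulr0.
rewrite uE// mulr_sumr; apply: eq_bigr => i _; rewrite /bump/= add1n subSS.
by rewrite [x ^+ i.+2]exprS; ring.
Qed.

End recursive_coefficients.

(** * Lebesgue integrals: affine substitution, powers, densities *)
Section affine.
Context {R : realType}.
Notation mu := (@lebesgue_measure R).

(** Lebesgue measure and [c] times its image under the affine map agree on the
    half-open intervals, hence everywhere. *)
Lemma ge0_integral_affine (c b : R) (f : R -> \bar R) : 0 < c ->
  measurable_fun [set: R] f -> (forall x, 0 <= f x)%E ->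
  (\int[mu]_x f x = c%:E * \int[mu]_x f (c * x + b)%R)%E.
Proof.
move=> c0 mf f0.
pose g (x : measurableTypeR R) : measurableTypeR R := c * x + b.
have mg : measurable_fun setT g.
  by apply: measurable_funD => //; exact: measurable_funM.
pose m : {measure set (measurableTypeR R) -> \bar R} :=
  measure_function_pushforward__canonical__measure_function_Measure mu mg.
have muE A : measurable A -> mu A = mscale (NngNum (ltW c0)) m A.
  apply: lebesgue_measure_unique => _ [[u v] _ <-].
  change (mu `]u, v]%classic = c%:E * mu (g @^-1` `]u, v]%classic))%E.
  rewrite (_ : g @^-1` _ = `](u - b) / c, (v - b) / c]%classic); last first.
    apply/seteqP; split => x; rewrite /g/= !in_itv/=;
    rewrite ltr_pdivrMr// ler_pdivlMr// ltrBlDr lerBrDr [x * c]mulrC//.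
  rewrite !lebesgue_measure_itv/= !lte_fin ltr_pM2r ?invr_gt0// ltrD2r.
  case: ifPn => uv; last by rewrite mule0.
  by rewrite -!EFinD -EFinM; congr EFin; field; rewrite gt_eqF.
rewrite (eq_measure_integral (mscale (NngNum (ltW c0)) m)); last first.
  by move=> A mA _; exact: muE.
by rewrite ge0_integral_mscale// ge0_integral_pushforward.
Qed.

End affine.

Section power_integral.
Context {R : realType}.
Notation mu := (@lebesgue_measure R).

Lemma continuous_powRl (s x : R) : 0 < x -> {for x, continuous (@powR R ^~ s)}.
Proof.
move=> x0; apply/differentiable_continuous/derivable1_diffP.
by apply: derivable_powR; rewrite in_itv/= x0.
Qed.

Lemma integral_powR_cc (s e x : R) : 0 < e -> e < x ->
  (\int[mu]_(y in `[e, x]) (s * y `^ (s - 1))%:E = (x `^ s - e `^ s)%:E)%E.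
Proof.
move=> e0 ex; rewrite (@continuous_FTC2 _ _ (@powR R ^~ s))//.
- apply/continuous_in_subspaceT => y; rewrite inE/= in_itv/= => /andP[ey _].
  have y0 := lt_le_trans e0 ey.
  by apply: cvgMr; exact: continuous_powRl.
- split=> [y|| ].
  + rewrite in_itv/= => /andP[ey _]; apply: derivable_powR.
    by rewrite in_itv/= andbT (lt_trans e0).
  + by apply/cvg_at_right_filter/continuous_powRl.
  + by apply/cvg_at_left_filter/continuous_powRl; rewrite (lt_trans e0).
- move=> y; rewrite in_itv/= => /andP[ey _]; apply: powR_derive1.
  by rewrite in_itv/= andbT (lt_trans e0).
Qed.

(** The integrand is unbounded at [0] when [s < 1], so the fundamental theorem
    of calculus is applied on intervals that exhaust [`]0, x]]. *)
Lemma integral_powR_oc (s x : R) : 0 < s -> 0 < x ->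
  (\int[mu]_(y in `]0%R, x]) (s * y `^ (s - 1))%:E = (x `^ s)%:E)%E.
Proof.
move=> s0 x0; pose F n : set R := `[x / n.+2%:R, x]%classic.
have xn0 n : 0 < x / n.+2%:R by rewrite divr_gt0.
have xnx n : x / n.+2%:R < x by rewrite ltr_pdivrMr// ltr_pMr// ltr1n.
have -> : `]0, x]%classic = \bigcup_n F n.
  apply/seteqP; split => [y|y [n _]]; rewrite /F/= !in_itv/=.
    move=> /andP[y0 yx]; have [n] := ltr_add_invr (divr_gt0 y0 x0).
    rewrite add0r => ny; exists n => //; rewrite /= in_itv/= yx andbT.
    rewrite -ler_pdivlMl// mulrC (le_trans _ (ltW ny))//.
    by rewrite lef_pV2 ?posrE// ler_nat.
  by move=> /andP[xy ->]; rewrite (lt_le_trans (xn0 n) xy).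
have /cvg_lim <- // :
   (\int[mu]_(y in F n) (s * y `^ (s - 1))%:E @[n --> \oo] -->
    \int[mu]_(y in \bigcup_n F n) (s * y `^ (s - 1))%:E)%E.
  apply: ge0_nondecreasing_set_cvg_integral.
  - move=> m n mn; apply/subsetPset => y; rewrite /F/= !in_itv/= => /andP[h ->].
    rewrite andbT (le_trans _ h)// ler_pM2l// lef_pV2 ?posrE//.
    by rewrite ler_nat ltnS.
  - by move=> n; exact: measurable_itv.
  - move=> n; apply/measurable_EFinP; apply: measurable_funTS.
    by apply: measurable_funM => //; exact: measurable_powR.
  - by move=> n y _; rewrite lee_fin mulr_ge0// ?powR_ge0// ltW.
under eq_fun do rewrite integral_powR_cc//.
apply/cvg_lim => //; apply: cvg_EFin; first by near=> n.
rewrite -[X in _ --> X]subr0; apply: cvgB; first exact: cvg_cst.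
move/cvg_at_rightP : (powR_cvg0 s0); apply; split=> [n|]; first exact: xn0.
rewrite -(mulr0 x); apply: cvgMr.
have := @cvg_harmonic R; rewrite -cvg_shiftS; exact.
Unshelve. all: by end_near. Qed.

End power_integral.

(** * The Gamma function *)
Section gamma_kernel.
Context {R : realType}.
Notation mu := (@lebesgue_measure R).

(** The gamma density without its normalising constant. The rate [0] is
    meaningful here: it gives the truncated power, out of which the Beta
    integral is made. *)
Definition gamma_kernel (a s x : R) : R :=
  if 0 < x then x `^ (s - 1) * expR (- a * x) else 0.

Lemma gamma_kernel_ge0 a s x : 0 <= gamma_kernel a s x.
Proof.
rewrite /gamma_kernel; case: ifP => // _.
by rewrite mulr_ge0 ?powR_ge0 ?expR_ge0.
Qed.

Lemma measurable_gamma_kernel a s : measurable_fun [set: R] (gamma_kernel a s).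
Proof.
apply: measurable_fun_ifT => //; first exact: measurable_fun_ltr.
apply: measurable_funM; first exact: measurable_powR.
by apply: measurableT_comp => //; exact: measurable_funM.
Qed.

Lemma gamma_kernelZ a s c x : 0 < c ->
  gamma_kernel a s (c * x) = c `^ (s - 1) * gamma_kernel (a * c) s x.
Proof.
move=> c0; rewrite /gamma_kernel pmulr_rgt0//.
case: ifP => [x0|_]; last by rewrite mulr0.
by rewrite powRM ?ltW// mulNr mulNr !mulrA.
Qed.

Lemma integral_bool_set (P : R -> bool) (f : R -> \bar R) :
  (\int[mu]_(x in [set x | P x]) f x = \int[mu]_x (if P x then f x else 0))%E.
Proof.
rewrite integral_mkcond; apply: eq_integral => x _; rewrite patchE.
by rewrite mem_setE.
Qed.

(** Valued in the extended reals so that the functional equation of the Gamma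
    function can be proved first and finiteness deduced from it. *)
Definition gamma_mass (a s : R) : \bar R :=
  (\int[mu]_x (gamma_kernel a s x)%:E)%E.

Lemma gamma_mass_ge0 a s : (0 <= gamma_mass a s)%E.
Proof. by apply: integral_ge0 => x _; rewrite lee_fin gamma_kernel_ge0. Qed.

Lemma gamma_mass_itv a s : (gamma_mass a s =
  \int[mu]_(x in `]0%R, +oo[) (x `^ (s - 1) * expR (- a * x))%:E)%E.
Proof.
rewrite /gamma_mass (_ : `]0%R, +oo[%classic = [set x : R | 0 < x]); last first.
  by apply/seteqP; split => x /=; rewrite in_itv/= andbT.
rewrite integral_bool_set; apply: eq_integral => x _.
by rewrite /gamma_kernel; case: ifP.
Qed.

Lemma integral_expR_tail (y : R) :
  (\int[mu]_(x in `[y, +oo[) (expR (- x))%:E = (expR (- y))%:E)%E.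
Proof.
rewrite (@ge0_continuous_FTC2y _ _ (fun x => - expR (- x)) _ 0)//.
- by rewrite EFinN sub0e oppeK.
- apply/continuous_subspaceT => x.
  apply: continuous_comp; first exact: opp_continuous.
  exact: continuous_expR.
- by rewrite -oppr0; apply: cvgN; exact: cvgr_expR.
- apply: cvgN; apply/cvg_at_right_filter.
  by apply: continuous_comp; [exact: opp_continuous|exact: continuous_expR].
- move=> x _; rewrite derive1E derive_val.
  by rewrite mulrN1 opprK.
Qed.

Lemma lebesgue_tonelli (f : R * R -> \bar R) :
  measurable_fun [set: R * R] f -> (forall z, 0 <= f z)%E ->
  (\int[mu]_x \int[mu]_y f (x, y) = \int[mu]_y \int[mu]_x f (x, y))%E.
Proof.
move=> mf f0.
exact: (@fubini_tonelli _ _ (measurableTypeR R) (measurableTypeR R) R mu mu f).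
Qed.

(** Tonelli's theorem for [s y^(s-1) e^(-x)] on the region [0 < y <= x]:
    integrating [y] out first gives [x^s e^(-x)], integrating [x] out first
    gives [s y^(s-1) e^(-y)]. *)
Lemma gamma_mass_rec (s : R) : 0 < s ->
  (gamma_mass 1 (s + 1) = s%:E * gamma_mass 1 s)%E.
Proof.
move=> s0.
pose f (z : R * R) : \bar R :=
  (if (0 < z.2) && (z.2 <= z.1)
   then s * z.2 `^ (s - 1) * expR (- z.1) else 0)%:E.
have mf : measurable_fun setT f.
  apply/measurable_EFinP; apply: measurable_fun_ifT => //.
    apply: measurable_and; first exact: measurable_fun_ltr.
    exact: measurable_fun_ler.
  apply: measurable_funM; last first.
    by apply: measurableT_comp => //; exact: measurableT_comp.
  apply: measurable_funM => //.
  exact: (measurableT_comp (measurable_powR (s - 1)) measurable_snd).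
have f0 z : (0 <= f z)%E.
  rewrite /f lee_fin; case: ifP => // _.
  by rewrite !mulr_ge0// ?powR_ge0 ?expR_ge0 ?ltW.
have FE x : (\int[mu]_y f (x, y) = (gamma_kernel 1 (s + 1) x)%:E)%E.
  rewrite /f/= /gamma_kernel addrK mulN1r; case: ifPn => [x0|]; last first.
    rewrite -leNgt => x0; apply: integral0_eq => y _.
    case: ifPn => // /andP[y0 yx].
    by have := lt_le_trans y0 (le_trans yx x0); rewrite ltxx.
  rewrite -[X in X%:E]mulrC.
  rewrite EFinM -(integral_powR_oc s0 x0) -ge0_integralZl//; last 2 first.
  - apply/measurable_EFinP; apply: measurable_funTS.
    by apply: measurable_funM => //; exact: measurable_powR.
  - by move=> y _; rewrite lee_fin mulr_ge0 ?powR_ge0// ltW.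
  rewrite (_ : `]0%R, x]%classic = [set y : R | (0 < y) && (y <= x)]);
    last first.
    by apply/seteqP; split => y /=; rewrite in_itv.
  rewrite integral_bool_set; apply: eq_integral => y _; case: ifP => // _.
  by rewrite -EFinM mulrC.
have GE y : (\int[mu]_x f (x, y) = s%:E * (gamma_kernel 1 s y)%:E)%E.
  rewrite /f/= /gamma_kernel; case: ifPn => [y0|]/=; last first.
    by move=> y0; rewrite mule0; apply: integral0_eq.
  rewrite mulN1r -EFinM mulrA EFinM -integral_expR_tail.
  rewrite -ge0_integralZl//; last 2 first.
  - apply/measurable_EFinP; apply: measurable_funTS.
    exact: measurableT_comp.
  - by rewrite lee_fin mulr_ge0 ?powR_ge0// ltW.
  rewrite (_ : `[y, +oo[%classic = [set x : R | y <= x]); last first.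
    by apply/seteqP; split => x /=; rewrite in_itv/= andbT.
  rewrite integral_bool_set; apply: eq_integral => x _; case: ifP => // _.
rewrite /gamma_mass; under eq_integral do rewrite -FE.
rewrite lebesgue_tonelli//; under eq_integral do rewrite GE.
rewrite ge0_integralZl//.
- by apply/measurable_EFinP; exact: measurable_gamma_kernel.
- by move=> x _; rewrite lee_fin gamma_kernel_ge0.
- by rewrite lee_fin ltW.
Qed.

Lemma gamma_mass1 : (gamma_mass 1 1 = 1)%E.
Proof.
rewrite gamma_mass_itv; under eq_integral do rewrite subrr powRr0 mul1r mulN1r.
rewrite integral_itv_obnd_cbnd ?integral_expR_tail ?oppr0 ?expR0//.
apply/measurable_EFinP; apply: measurable_funTS; exact: measurableT_comp.
Qed.

Lemma gamma_mass_nat n : (gamma_mass 1 n.+1%:R < +oo)%E.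
Proof.
elim: n => [|n IH]; first by rewrite gamma_mass1 ltry.
by rewrite -natr1 gamma_mass_rec// lte_mul_pinfty// lee_fin.
Qed.

(** At integers this is the functional equation. In general
    [x^s <= 1 + x^n] for an integer [n >= s] bounds the mass at [s + 1], and the
    functional equation brings it down to [s], which may be less than [1]. *)
Lemma gamma_mass_lty (s : R) : 0 < s -> (gamma_mass 1 s < +oo)%E.
Proof.
move=> s0.
have [n sn] : exists n, s <= n%:R.
  by exists (Num.bound s); rewrite ltW// archi_boundP// ltW.
suff : (gamma_mass 1 (s + 1) < +oo)%E.
  rewrite gamma_mass_rec//; case: (gamma_mass 1 s) (gamma_mass_ge0 1 s) => //=.
    by move=> r _ _; exact: ltry.
  by move=> _; rewrite gt0_muley// ltxx.
apply: (@le_lt_trans _ _ (gamma_mass 1 1 + gamma_mass 1 n.+1%:R)%E); last first.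
  by apply: lte_add_pinfty; [rewrite gamma_mass1 ltry|exact: gamma_mass_nat].
rewrite -ge0_integralD//; last 4 first.
- by move=> x _; rewrite lee_fin gamma_kernel_ge0.
- by apply/measurable_EFinP; exact: measurable_gamma_kernel.
- by move=> x _; rewrite lee_fin gamma_kernel_ge0.
- by apply/measurable_EFinP; exact: measurable_gamma_kernel.
apply: ge0_le_integral => //.
- by move=> x _; rewrite lee_fin gamma_kernel_ge0.
- by apply/measurable_EFinP; exact: measurable_gamma_kernel.
- apply/measurable_EFinP.
  by apply: measurable_funD; exact: measurable_gamma_kernel.
move=> x _; rewrite -EFinD lee_fin /gamma_kernel.
case: ifP => x0; last by rewrite addr0.
rewrite -mulrDl ler_wpM2r ?expR_ge0// subrr powRr0 addrK -natr1 addrK.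
have [x1|x1] := leP x 1.
  rewrite (@le_trans _ _ (1 `^ s))//; last by rewrite powR1 lerDl powR_ge0.
  by rewrite ge0_ler_powR ?nnegrE ?(ltW x0) ?(ltW s0).
rewrite (@le_trans _ _ (x `^ n%:R))//; last by rewrite lerDr.
by rewrite ler_powR// ltW.
Qed.

(** On [`]0, 1]] the factor [e^(-x)] is at least [e^(-1)], and the integral of
    [s x^(s-1)] is [1]. *)
Lemma gamma_mass_gt0 (s : R) : 0 < s -> (0 < gamma_mass 1 s)%E.
Proof.
move=> s0.
have : ((expR (-1))%:E <= s%:E * gamma_mass 1 s)%E.
  rewrite -[leLHS]mule1 [X in (_ * X)%E](_ : _ = (1 `^ s)%:E); last first.
    by rewrite powR1.
  rewrite -integral_powR_oc//.
  rewrite -ge0_integralZl//; last 2 first.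
  - apply/measurable_EFinP; apply: measurable_funTS.
    by apply: measurable_funM => //; exact: measurable_powR.
  - by move=> x _; rewrite lee_fin mulr_ge0 ?powR_ge0// ltW.
  rewrite /gamma_mass -ge0_integralZl//; last 3 first.
  - by apply/measurable_EFinP; exact: measurable_gamma_kernel.
  - by move=> x _; rewrite lee_fin gamma_kernel_ge0.
  - by rewrite lee_fin ltW.
  rewrite (_ : `]0%R, 1%R]%classic = [set y : R | (0 < y) && (y <= 1)]);
    last first.
    by apply/seteqP; split => y /=; rewrite in_itv.
  rewrite integral_bool_set; apply: ge0_le_integral => //.
  - move=> x _; case: ifP => // _.
    by rewrite -EFinM lee_fin !mulr_ge0 ?expR_ge0 ?powR_ge0 ?ltW.
  - apply: measurable_fun_ifT => //.
      apply: measurable_and; first exact: measurable_fun_ltr.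
      exact: measurable_fun_ler.
    apply/measurable_EFinP; apply: measurable_funM => //.
    by apply: measurable_funM => //; exact: measurable_powR.
  - apply/measurable_EFinP; apply: measurable_funM => //.
    exact: measurable_gamma_kernel.
  move=> x _; rewrite /gamma_kernel; case: ifPn => [/andP[x0 x1]|_].
    rewrite x0 -!EFinM lee_fin mulrCA ler_pM2l// mulrC.
    rewrite ler_wpM2l ?powR_ge0//.
    by rewrite mulN1r ler_expR lerN2.
  by rewrite -EFinM lee_fin mulr_ge0 ?gamma_kernel_ge0// ltW.
case: (gamma_mass 1 s) (gamma_mass_ge0 1 s) => //= r.
rewrite !lee_fin lte_fin => r0; rewrite lt_neqAle r0 andbT.
by apply: contraTneq => <-; rewrite mulr0 -ltNge expR_gt0.
Qed.

End gamma_kernel.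

Section density.
Local Open Scope ereal_scope.
Context d (T : measurableType d) (R : realType).
Variables (mu nu : {measure set T -> \bar R}) (f : T -> R).
Hypotheses (mf : measurable_fun [set: T] f) (f0 : forall x, (0 <= f x)%R).
Hypothesis nuE : forall A, measurable A -> nu A = \int[mu]_(x in A) (f x)%:E.

Import HBNNSimple.

Let density_nnsfun (h : {nnsfun T >-> R}) :
  \int[nu]_x (h x)%:E = \int[mu]_x ((h x)%:E * (f x)%:E).
Proof.
under [LHS]eq_integral do rewrite fimfunE -fsumEFin//.
rewrite [LHS]ge0_integral_fsum//; last 2 first.
  - by move=> r; exact/measurable_EFinP/measurableT_comp.
  - by move=> n x _; rewrite EFinM nnfun_muleindic_ge0.
under [RHS]eq_integral.
  move=> x xD; rewrite fimfunE -fsumEFin// ge0_mule_fsuml; last first.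
    by move=> r; rewrite EFinM nnfun_muleindic_ge0.
  over.
have mg r : measurable_fun [set: T] (fun x => (r * \1_(h @^-1` [set r]) x)%:E).
  by apply/measurable_EFinP; exact: measurable_funM.
rewrite [RHS]ge0_integral_fsum//; last 2 first.
  - by move=> r; apply: emeasurable_funM => //; exact/measurable_EFinP.
  - move=> n x _; apply: mule_ge0; last by rewrite lee_fin.
    by rewrite EFinM nnfun_muleindic_ge0.
apply: eq_fsbigr => r rh.
have r0 : (0 <= r)%R by move: rh; rewrite inE => -[x _ <-].
rewrite integralZl_indic_nnsfun//= integral_indic// setIT nuE//.
under [RHS]eq_integral do rewrite EFinM -muleA.
rewrite ge0_integralZl//; last 2 first.
  - by apply: emeasurable_funM; exact/measurable_EFinP.
  - by move=> x _; rewrite mule_ge0 ?lee_fin.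
congr *%E; rewrite integral_mkcond; apply: eq_integral => x _.
by rewrite patchE indicE; case: ifP => _; rewrite ?mul1e ?mul0e.
Qed.

(** For simple functions this is linearity and the definition of [nu]; the
    general case follows by monotone convergence. *)
Lemma ge0_integral_density (h : T -> \bar R) : measurable_fun [set: T] h ->
  (forall x, 0 <= h x) -> \int[nu]_x h x = \int[mu]_x (h x * (f x)%:E).
Proof.
move=> mh h0; pose h_ := nnsfun_approx measurableT mh.
have hE x : limn (fun n => (h_ n x)%:E) = h x.
  by apply/cvg_lim => //; exact: cvg_nnsfun_approx.
transitivity (limn (fun n => \int[nu]_x (h_ n x)%:E)).
  rewrite -monotone_convergence//=.
  - by apply: eq_integral => x _; rewrite hE.
  - by move=> n; exact/measurable_EFinP.
  - by move=> n x _; rewrite lee_fin.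
  - by move=> x _ a b ab; rewrite lee_fin//; exact/lefP/nd_nnsfun_approx.
under eq_fun do rewrite density_nnsfun.
rewrite -monotone_convergence//=.
- apply: eq_integral => x _; apply/cvg_lim => //.
  by apply: cvgeZr => //; exact: cvg_nnsfun_approx.
- by move=> n; apply: emeasurable_funM; exact/measurable_EFinP.
- by move=> n x _; rewrite mule_ge0 ?lee_fin.
- move=> x _ a b ab; rewrite lee_wpmul2r ?lee_fin//.
  exact/lefP/nd_nnsfun_approx.
Qed.

End density.

(** * Gamma laws as probability measures *)
Section gamma_law.
Context {R : realType}.
Notation mu := (@lebesgue_measure R).
Implicit Types a s : R.

Lemma gamma_funE s : 0 < s -> (gamma_fun s)%:E = gamma_mass 1 s.
Proof.
move=> s0; have E : (gamma_mass 1 s =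
    \int[mu]_(x in `]0%R, +oo[) (x `^ (s - 1) * expR (- x))%:E)%E.
  by rewrite gamma_mass_itv; under eq_integral do rewrite mulN1r.
rewrite /gamma_fun /Rintegral -E fineK//.
by rewrite ge0_fin_numE ?gamma_mass_ge0 ?gamma_mass_lty.
Qed.

Lemma gamma_fun_gt0 s : 0 < s -> 0 < gamma_fun s.
Proof. by move=> s0; rewrite -lte_fin gamma_funE// gamma_mass_gt0. Qed.

Lemma gamma_funS s : 0 < s -> gamma_fun (s + 1) = s * gamma_fun s.
Proof.
move=> s0; apply: EFin_inj.
by rewrite EFinM !gamma_funE ?addr_gt0// gamma_mass_rec.
Qed.

Lemma gamma_massZ a s : 0 < a -> 0 < s ->
  gamma_mass a s = (gamma_fun s / a `^ s)%:E.
Proof.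
move=> a0 s0; have ai : 0 < a^-1 by rewrite invr_gt0.
have mk : measurable_fun [set: R] (fun x => (gamma_kernel a s x)%:E).
  by apply/measurable_EFinP; exact: measurable_gamma_kernel.
rewrite /gamma_mass (ge0_integral_affine 0 ai)//; last first.
  by move=> x; rewrite lee_fin gamma_kernel_ge0.
under eq_integral do rewrite addr0 gamma_kernelZ// divff ?gt_eqF// EFinM.
rewrite ge0_integralZl//.
- rewrite muleA -/(gamma_mass 1 s) -gamma_funE// -!EFinM; congr EFin.
  by rewrite mulr_powRB1 ?ltW// -powR_inv1 ?ltW// -powRrM mulN1r powRN mulrC.
- by apply/measurable_EFinP; exact: measurable_gamma_kernel.
- by move=> x _; rewrite lee_fin gamma_kernel_ge0.
- by rewrite lee_fin powR_ge0.
Qed.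

Lemma gamma_pdfE a s x :
  gamma_pdf a s x = a `^ s / gamma_fun s * gamma_kernel a s x.
Proof.
rewrite /gamma_pdf /gamma_kernel patchE.
have -> : (x \in `]0, +oo[%classic) = (0 < x).
  by rewrite mem_setE in_itv/= andbT.
by case: ifP => _; rewrite ?mulr0.
Qed.

Lemma gamma_pdf_ge0 a s x : 0 < s -> 0 <= gamma_pdf a s x.
Proof.
move=> s0; rewrite gamma_pdfE mulr_ge0 ?gamma_kernel_ge0//.
by rewrite divr_ge0 ?powR_ge0 ?ltW ?gamma_fun_gt0.
Qed.

Lemma measurable_gamma_pdf a s : measurable_fun [set: R] (gamma_pdf a s).
Proof.
rewrite (funext (gamma_pdfE a s)); apply: measurable_funM => //.
exact: measurable_gamma_kernel.
Qed.

Lemma integral_gamma_pdf a s : 0 < a -> 0 < s ->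
  (\int[mu]_x (gamma_pdf a s x)%:E = 1)%E.
Proof.
move=> a0 s0; under eq_integral do rewrite gamma_pdfE EFinM.
rewrite ge0_integralZl//.
- rewrite -/(gamma_mass a s) gamma_massZ// -EFinM; congr EFin.
  by field; rewrite !gt_eqF ?powR_gt0 ?gamma_fun_gt0.
- by apply/measurable_EFinP; exact: measurable_gamma_kernel.
- by move=> x _; rewrite lee_fin gamma_kernel_ge0.
- by rewrite lee_fin divr_ge0 ?powR_ge0 ?ltW ?gamma_fun_gt0.
Qed.

(** The Dirac mass at [0] is the natural value at shape [0]: it is the unit of
    convolution, so [Ga(a, s) * Ga(a, t) = Ga(a, s + t)] still holds there and
    an empty sum of gamma variables has a gamma law. Using it for all degenerate
    parameters makes [gamma_law a s] a probability measure without side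
    conditions. *)
Definition gamma_law a s : set R -> \bar R :=
  if (0 < a) && (0 < s) then gamma_prob a s else \d_(0 : R).

Lemma gamma_lawE a s : 0 < a -> 0 < s -> gamma_law a s = gamma_prob a s.
Proof. by rewrite /gamma_law => -> ->. Qed.

Lemma gamma_law0 a : gamma_law a 0 = \d_(0 : R).
Proof. by rewrite /gamma_law ltxx andbF. Qed.

Let gamma_law_set0 a s : gamma_law a s set0 = 0%E.
Proof.
rewrite /gamma_law; case: ifP => _; last exact: measure0.
by rewrite /gamma_prob integral_set0.
Qed.

Let gamma_law_ge0 a s A : (0 <= gamma_law a s A)%E.
Proof.
rewrite /gamma_law; case: ifP => [/andP[a0 s0]|_]; last exact: measure_ge0.
by apply: integral_ge0 => x _; rewrite lee_fin gamma_pdf_ge0.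
Qed.

Let gamma_law_sigma_additive a s : semi_sigma_additive (gamma_law a s).
Proof.
rewrite /gamma_law; case: ifP => [/andP[a0 s0]|_]; last first.
  exact: measure_semi_sigma_additive.
move=> /= F mF tF mUF; rewrite /gamma_prob; apply: cvg_toP.
  apply: ereal_nondecreasing_is_cvgn => m n mn.
  apply: lee_sum_nneg_natr => // k _ _; apply: integral_ge0 => /= x Fkx.
  by rewrite lee_fin gamma_pdf_ge0.
rewrite ge0_integral_bigcup//=.
- by apply/measurable_funTS/measurableT_comp => //; exact: measurable_gamma_pdf.
- by move=> x _; rewrite lee_fin gamma_pdf_ge0.
Qed.

HB.instance Definition _ a s := isMeasure.Build _ _ _ (gamma_law a s)
  (gamma_law_set0 a s) (gamma_law_ge0 a s) (@gamma_law_sigma_additive a s).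

Let gamma_law_setT a s : gamma_law a s [set: R] = 1%E.
Proof.
rewrite /gamma_law; case: ifP => [/andP[a0 s0]|_]; last by rewrite diracT.
exact: integral_gamma_pdf.
Qed.

HB.instance Definition _ a s :=
  @Measure_isProbability.Build _ _ R (gamma_law a s) (gamma_law_setT a s).

End gamma_law.

Section gamma_scaling.
Context {R : realType}.
Notation mu := (@lebesgue_measure R).
Implicit Types a s c x : R.

Lemma gamma_pdfZ a s c x : 0 < a -> 0 < s -> 0 < c ->
  c * gamma_pdf (a / c) s (c * x) = gamma_pdf a s x.
Proof.
move=> a0 s0 c0; rewrite !gamma_pdfE gamma_kernelZ// divfK ?gt_eqF//.
have -> : a `^ s = (a / c) `^ s * (c * c `^ (s - 1)).
  by rewrite mulr_powRB1 ?ltW// -powRM ?divr_ge0 ?ltW// divfK ?gt_eqF.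
by ring.
Qed.

Lemma gamma_prob_indic a s (A : set R) :
  (gamma_prob a s A = \int[mu]_x ((\1_A x)%:E * (gamma_pdf a s x)%:E))%E.
Proof.
rewrite /gamma_prob integral_mkcond; apply: eq_integral => x _.
by rewrite patchE indicE; case: ifP => _; rewrite ?mul1e ?mul0e.
Qed.

(** The substitution [y = c x] in the integral of the density: this is how a
    weight [c] enters the rate of a gamma variable. *)
Lemma gamma_law_scale a s c (A : set R) :
  0 < a -> 0 < s -> 0 < c -> measurable A ->
  gamma_law a s [set x | A (c * x)] = gamma_law (a / c) s A.
Proof.
move=> a0 s0 c0 mA.
rewrite (gamma_lawE a0 s0) (gamma_lawE (divr_gt0 a0 c0) s0).
rewrite [LHS]gamma_prob_indic [RHS]gamma_prob_indic.
rewrite [RHS](ge0_integral_affine 0 c0); last 2 first.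
- apply/measurable_EFinP; apply: measurable_funM => //.
  exact: measurable_gamma_pdf.
- by move=> x; rewrite mule_ge0// lee_fin ?gamma_pdf_ge0.
rewrite -ge0_integralZl//; last 3 first.
- apply: (measurableT_comp
    (f := fun y => (\1_A y)%:E * (gamma_pdf (a / c) s y)%:E)%E).
    apply/measurable_EFinP; apply: measurable_funM => //.
    exact: measurable_gamma_pdf.
  by apply: measurable_funD => //; exact: measurable_funM.
- by move=> x _; rewrite mule_ge0// lee_fin ?gamma_pdf_ge0.
- by rewrite lee_fin ltW.
apply: eq_integral => x _; rewrite addr0 -!EFinM mulrCA gamma_pdfZ//.
Qed.

End gamma_scaling.

(** * Expansion of a gamma law in gamma laws of a larger rate *)
Section negative_binomial.
Context {R : realType}.
Notation mu := (@lebesgue_measure R).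
Implicit Types a p r x : R.

Lemma nneseries_expR x :
  (\sum_(0 <= k <oo) (x ^+ k / k`!%:R)%:E = (expR x)%:E)%E.
Proof.
rewrite expRE -EFin_lim; last first.
  rewrite /pseries/=; under eq_fun do rewrite mulrC.
  exact: is_cvg_series_exp_coeff.
apply/congr_lim/funext => n/=; rewrite /pseries/= /series/= -sumEFin//.
by under [RHS]eq_bigr do rewrite mulrC.
Qed.

(** The negative binomial distribution, normally written
    [r^p (1 - r)^k Gamma(p + k) / (Gamma(p) k!)]. In this form convolution of
    such distributions is an instance of [rec_coefD]. *)
Definition negbin_pmf p r k : R :=
  r `^ p * rec_coef (fun i => i%:R^-1 * (p * (1 - r) ^+ i)) k.

Lemma negbin_pmfE p r k : 0 < p ->
  negbin_pmf p r k =
  r `^ p * (1 - r) ^+ k * gamma_fun (p + k%:R) / (gamma_fun p * k`!%:R).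
Proof.
move=> p0; rewrite /negbin_pmf -!mulrA; congr (_ * _).
have Gp : gamma_fun p != 0 by rewrite gt_eqF ?gamma_fun_gt0.
elim: k => [|k IH].
  by rewrite rec_coef0 addr0 fact0 mulr1 mul1r divff.
apply: (@mulfI _ k.+1%:R); first by rewrite pnatr_eq0.
rewrite rec_coef_geom IH -natr1 addrA gamma_funS ?ltr_pwDl//.
rewrite factS natrM natr1 exprS; field.
by rewrite pnatr_eq0 -lt0n fact_gt0 Gp/= addrC natr1 pnatr_eq0.
Qed.

Lemma negbin_pmf_ge0 p r k : 0 < p -> 0 < r <= 1 -> 0 <= negbin_pmf p r k.
Proof.
move=> p0 /andP[r0 r1]; rewrite mulr_ge0 ?powR_ge0// rec_coef_ge0// => i i0.
by rewrite !mulr_ge0 ?invr_ge0 ?exprn_ge0 ?subr_ge0// ltW.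
Qed.

(** [e^(-r a x) = e^(-a x) e^((1-r) a x)], and the powers of [x] in the
    expansion of the second exponential raise the shape. *)
Lemma gamma_pdf_negbin a p r x : 0 < a -> 0 < p -> 0 < r <= 1 ->
  ((gamma_pdf (r * a) p x)%:E =
   \sum_(0 <= k <oo) (negbin_pmf p r k * gamma_pdf a (p + k%:R) x)%:E)%E.
Proof.
move=> a0 p0 /andP[r0 r1].
have [x0|x0] := ltP 0 x; last first.
  rewrite !gamma_pdfE /gamma_kernel ltNge x0/= mulr0 eseries0// => k _ _.
  by rewrite gamma_pdfE /gamma_kernel ltNge x0/= !mulr0.
pose c := (r * a) `^ p / gamma_fun p * (x `^ (p - 1) * expR (- a * x)).
have c0 : 0 <= c.
  by rewrite !mulr_ge0 ?invr_ge0 ?powR_ge0 ?expR_ge0// ltW// gamma_fun_gt0.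
rewrite (eq_eseriesr
  (g := fun k => c%:E * (((1 - r) * a * x) ^+ k / k`!%:R)%:E)%E); last first.
  move=> k _; rewrite -EFinM; congr EFin.
  rewrite negbin_pmfE// gamma_pdfE /gamma_kernel x0 /c.
  have pk : p + k%:R - 1 = p - 1 + k%:R by ring.
  have powD (y q : R) : 0 < y -> y `^ (q + k%:R) = y `^ q * y ^+ k.
    by move=> y0; rewrite powRD ?(gt_eqF y0) ?implybT// powR_mulrn// ltW.
  rewrite pk !powD//.
  rewrite powRM ?ltW// !exprMn; field.
  by rewrite pnatr_eq0 -lt0n fact_gt0 !gt_eqF ?gamma_fun_gt0 ?ltr_pwDl.
rewrite nneseriesZl//; last first.
  move=> k _; rewrite lee_fin divr_ge0// exprn_ge0//.
  by rewrite !mulr_ge0 ?subr_ge0// ltW.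
rewrite nneseries_expR -EFinM; congr EFin.
rewrite gamma_pdfE /gamma_kernel x0 /c -!mulrA -expRD.
by do 3 congr (_ * _); congr expR; ring.
Qed.

Lemma gamma_law_negbin a p r (A : set R) :
  0 < a -> 0 < p -> 0 < r <= 1 -> measurable A ->
  (gamma_law (r * a) p A =
   \sum_(0 <= k <oo) (negbin_pmf p r k)%:E * gamma_law a (p + k%:R) A)%E.
Proof.
move=> a0 p0 r01 mA; have r0 : 0 < r by case/andP : r01.
rewrite gamma_lawE ?mulr_gt0// /gamma_prob.
under eq_integral do rewrite (gamma_pdf_negbin _ a0 p0 r01).
rewrite integral_nneseries//.
- apply: eq_eseriesr => k _; rewrite gamma_lawE ?ltr_pwDl// /gamma_prob.
  under eq_integral do rewrite EFinM.
  rewrite ge0_integralZl//.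
  + by apply/measurable_EFinP/measurable_funTS; exact: measurable_gamma_pdf.
  + by move=> x _; rewrite lee_fin gamma_pdf_ge0// ltr_pwDl.
  + by rewrite lee_fin negbin_pmf_ge0.
- move=> k; apply/measurable_EFinP/measurable_funTS.
  apply: measurable_funM => //.
  exact: measurable_gamma_pdf.
- move=> k x _.
  by rewrite lee_fin mulr_ge0 ?negbin_pmf_ge0 ?gamma_pdf_ge0// ltr_pwDl.
Qed.

End negative_binomial.

(** * Convolution of gamma laws of the same rate *)
Section gamma_convolution.
Context {R : realType}.
Notation mu := (@lebesgue_measure R).
Implicit Types a s t x z : R.

(** The Beta integral [B(s, t)], valued in the extended reals: that it is finite
    comes out of the comparison of total masses in [gamma_law_conv_gt0]. *)
Definition beta_mass s t : \bar R :=
  (\int[mu]_u (gamma_kernel 0 s u * gamma_kernel 0 t (1 - u))%:E)%E.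

Lemma beta_mass_ge0 s t : (0 <= beta_mass s t)%E.
Proof.
by apply: integral_ge0 => u _; rewrite lee_fin mulr_ge0 ?gamma_kernel_ge0.
Qed.

Lemma measurable_gamma_kernel_sub a t z :
  measurable_fun [set: R] (fun x => gamma_kernel a t (z - x)).
Proof.
apply: (measurableT_comp (measurable_gamma_kernel a t)).
by apply: measurable_funB.
Qed.

(** Substitute [x = z u]: the exponentials multiply to [e^(-a z)], independently
    of [u], and the powers of [z] collect to [z^(s+t-1)]. *)
Lemma gamma_kernel_conv a s t z : 0 < s -> 0 < t ->
  (\int[mu]_x (gamma_kernel a s x * gamma_kernel a t (z - x))%:E =
   (gamma_kernel a (s + t) z)%:E * beta_mass s t)%E.
Proof.
move=> s0 t0; have [z0|z0] := ltP 0 z; last first.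
  rewrite [X in (_ = X%:E * _)%E]/gamma_kernel ltNge z0/= mul0e.
  rewrite integral0_eq// => x _.
  rewrite /gamma_kernel; case: ifPn => [x0|_]; last by rewrite mul0r.
  by rewrite ifN ?mulr0// -leNgt subr_le0 (le_trans z0)// ltW.
rewrite (ge0_integral_affine 0 z0); last 2 first.
- apply/measurable_EFinP; apply: measurable_funM.
    exact: measurable_gamma_kernel.
  exact: measurable_gamma_kernel_sub.
- by move=> x; rewrite lee_fin mulr_ge0 ?gamma_kernel_ge0.
have E x : gamma_kernel a s (z * x + 0) * gamma_kernel a t (z - (z * x + 0)) =
    z `^ (s - 1) * z `^ (t - 1) * expR (- a * z) *
    (gamma_kernel 0 s x * gamma_kernel 0 t (1 - x)).
  rewrite addr0 -[X in _ * gamma_kernel _ _ X](_ : z * (1 - x) = _);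
    last by ring.
  rewrite !gamma_kernelZ// /gamma_kernel.
  case: ifP => _; last by rewrite !(mulr0, mul0r).
  case: ifP => _; last by rewrite !(mulr0, mul0r).
  rewrite !(oppr0, mul0r) expR0 !mulr1.
  rewrite (_ : - a * z = - (a * z) * x + - (a * z) * (1 - x)); last by ring.
  by rewrite expRD; ring.
under eq_integral do rewrite E EFinM.
rewrite ge0_integralZl//; last 3 first.
- apply/measurable_EFinP; apply: measurable_funM.
    exact: measurable_gamma_kernel.
  exact: measurable_gamma_kernel_sub.
- by move=> x _; rewrite lee_fin mulr_ge0 ?gamma_kernel_ge0.
- by rewrite lee_fin !mulr_ge0 ?powR_ge0 ?expR_ge0.
rewrite muleA -EFinM; congr (_%:E * _)%E.
rewrite /gamma_kernel z0 !mulrA mulr_powRB1 ?ltW//; congr (_ * _).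
by rewrite -powRD ?(gt_eqF z0) ?implybT// addrA.
Qed.

Definition plus_set (A : set R) : set (R * R) := [set z | A (z.1 + z.2)].

Lemma measurable_plus_set A : measurable A -> measurable (plus_set A).
Proof.
move=> mA; rewrite -[plus_set A]setTI.
have : measurable_fun [set: R * R] (fun z : R * R => z.1 + z.2 : R).
  by apply: measurable_funD; [exact: measurable_fst|exact: measurable_snd].
exact.
Qed.

(** Gamma laws live on [R] and Lebesgue measure on its copy [measurableTypeR R],
    which has the same measurable sets but another display. The image of
    Lebesgue measure under the identity moves it to [R], where
    [ge0_integral_density] applies. *)
Lemma ge0_integral_gamma_law a s (h : R -> \bar R) : 0 < a -> 0 < s ->
  measurable_fun [set: R] h -> (forall x, 0 <= h x)%E ->
  (\int[gamma_law a s]_x h x = \int[mu]_x (h x * (gamma_pdf a s x)%:E))%E.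
Proof.
move=> a0 s0 mh h0.
have mid :
    measurable_fun [set: measurableTypeR R] (id : measurableTypeR R -> R).
  by move=> _ B mB; rewrite setTI.
pose muR : {measure set R -> \bar R} :=
  measure_function_pushforward__canonical__measure_function_Measure mu mid.
have mf := measurable_gamma_pdf a s.
rewrite (@ge0_integral_density _ _ _ muR _ (gamma_pdf a s))//.
- rewrite ge0_integral_pushforward//.
  + by apply: emeasurable_funM => //; exact/measurable_EFinP.
  + by move=> x _; rewrite mule_ge0// lee_fin gamma_pdf_ge0.
- by move=> x; exact: gamma_pdf_ge0.
- move=> B mB /=; rewrite gamma_lawE// ge0_integral_pushforward//.
  + by apply/measurable_EFinP/measurable_funTS.
  + by move=> x _; rewrite lee_fin gamma_pdf_ge0.
Qed.

(** After the shift [z = x + y] in the inner integral and Tonelli's theorem, the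
    density at [z] is the integral of [gamma_kernel_conv]. *)
Lemma gamma_law_conv_beta a s t (A : set R) : 0 < a -> 0 < s -> 0 < t ->
  measurable A ->
  ((gamma_law a s \x gamma_law a t) (plus_set A) =
   (a `^ s / gamma_fun s * (a `^ t / gamma_fun t))%:E * beta_mass s t *
   \int[mu]_z ((\1_A z)%:E * (gamma_kernel a (s + t) z)%:E))%E.
Proof.
move=> a0 s0 t0 mA.
pose g (z : R * R) : \bar R :=
  (\1_A z.2 * (gamma_pdf a s z.1 * gamma_pdf a t (z.2 - z.1)))%:E.
have g0 (z : R * R) : (0 <= g z)%E by rewrite lee_fin !mulr_ge0// gamma_pdf_ge0.
have mg : measurable_fun [set: R * R] g.
  apply/measurable_EFinP; apply: measurable_funM.
    exact: (measurableT_comp (f := \1_A : R -> R)).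
  apply: measurable_funM.
    exact: (measurableT_comp (measurable_gamma_pdf a s)).
  apply: (measurableT_comp (measurable_gamma_pdf a t)).
  by apply: measurable_funB.
have tE x : (gamma_law a t (xsection (plus_set A) x) =
    \int[mu]_z ((\1_A z)%:E * (gamma_pdf a t (z - x))%:E))%E.
  rewrite gamma_lawE// gamma_prob_indic.
  rewrite [RHS](ge0_integral_affine x ltr01); last 2 first.
  - apply/measurable_EFinP; apply: measurable_funM => //.
    apply: (measurableT_comp (measurable_gamma_pdf a t)).
    by apply: measurable_funB.
  - by move=> z; rewrite mule_ge0// lee_fin ?gamma_pdf_ge0.
  rewrite mul1e; apply: eq_integral => y _.
  rewrite mul1r addrK; congr (_%:E * _)%E; rewrite !indicE.
  by rewrite mem_xsection addrC.
transitivity (\int[mu]_x \int[mu]_z g (x, z))%E.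
  rewrite /product_measure1/=.
  rewrite ge0_integral_gamma_law//.
  - apply: eq_integral => x _; rewrite tE -ge0_integralZr//.
    + apply: eq_integral => z _; rewrite /g/= -!EFinM; congr EFin; ring.
    + apply/measurable_EFinP; apply: measurable_funM => //.
      apply: (measurableT_comp (measurable_gamma_pdf a t)).
      by apply: measurable_funB.
    + by move=> z _; rewrite mule_ge0// lee_fin ?gamma_pdf_ge0.
    + by rewrite lee_fin gamma_pdf_ge0.
  - exact: measurable_fun_xsection (measurable_plus_set mA).
rewrite lebesgue_tonelli// -ge0_integralZl//; last 3 first.
- apply/measurable_EFinP; apply: measurable_funM => //.
  exact: measurable_gamma_kernel.
- by move=> z _; rewrite mule_ge0// lee_fin ?gamma_kernel_ge0.
- rewrite mule_ge0 ?beta_mass_ge0// lee_fin.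
  by rewrite !mulr_ge0 ?invr_ge0 ?powR_ge0// ltW ?gamma_fun_gt0.
apply: eq_integral => z _; rewrite /g/=.
have E x : \1_A z * (gamma_pdf a s x * gamma_pdf a t (z - x)) =
    \1_A z * (a `^ s / gamma_fun s * (a `^ t / gamma_fun t)) *
    (gamma_kernel a s x * gamma_kernel a t (z - x)).
  by rewrite !gamma_pdfE -[RHS]mulrA; congr (_ * _); exact: mulrACA.
under eq_integral do rewrite E EFinM.
rewrite ge0_integralZl//.
- rewrite gamma_kernel_conv// muleA -!EFinM [RHS]muleAC -EFinM.
  by congr (_%:E * _)%E; rewrite -[LHS]mulrA; exact: mulrCA.
- apply/measurable_EFinP; apply: measurable_funM.
    exact: measurable_gamma_kernel.
  exact: measurable_gamma_kernel_sub.
- by move=> x _; rewrite lee_fin mulr_ge0 ?gamma_kernel_ge0.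
- by rewrite lee_fin !mulr_ge0 ?invr_ge0 ?powR_ge0// ltW ?gamma_fun_gt0.
Qed.

(** Both sides have densities proportional to the same kernel and total mass
    [1], so the constants agree. *)
Lemma gamma_law_conv_gt0 a s t (A : set R) : 0 < a -> 0 < s -> 0 < t ->
  measurable A ->
  ((gamma_law a s \x gamma_law a t) (plus_set A) = gamma_law a (s + t) A)%E.
Proof.
move=> a0 s0 t0 mA; have st0 : 0 < s + t by rewrite addr_gt0.
set K := ((a `^ s / gamma_fun s * (a `^ t / gamma_fun t))%:E * beta_mass s t)%E.
have lawE (B : set R) : measurable B -> gamma_law a (s + t) B =
  ((a `^ (s + t) / gamma_fun (s + t))%:E *
   \int[mu]_z ((\1_B z)%:E * (gamma_kernel a (s + t) z)%:E))%E.
  move=> mB; rewrite gamma_lawE// gamma_prob_indic -ge0_integralZl//.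
  - by apply: eq_integral => z _; rewrite gamma_pdfE -!EFinM mulrCA.
  - apply/measurable_EFinP; apply: measurable_funM => //.
    exact: measurable_gamma_kernel.
  - by move=> z _; rewrite mule_ge0// lee_fin ?gamma_kernel_ge0.
  - by rewrite lee_fin divr_ge0 ?powR_ge0// ltW ?gamma_fun_gt0.
suff KE : K = (a `^ (s + t) / gamma_fun (s + t))%:E.
  by rewrite gamma_law_conv_beta// -/K KE lawE.
(* The whole line determines the constant [K]. *)
have : (K * gamma_mass a (s + t) = 1)%E.
  have := gamma_law_conv_beta a0 s0 t0 measurableT; rewrite -/K.
  under eq_integral do rewrite indicT mul1e.
  move=> <-; rewrite [plus_set _](_ : _ = setT)//.
  exact: probability_setT.
have M0 : 0 < gamma_fun (s + t) / a `^ (s + t).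
  by rewrite divr_gt0 ?gamma_fun_gt0 ?powR_gt0.
rewrite gamma_massZ//; case: K => [k||].
- rewrite -EFinM => -[kM]; congr EFin.
  by rewrite -[RHS]invf_div -[RHS]mul1r -kM mulfK// gt_eqF.
- by rewrite gt0_mulye ?lte_fin.
- by rewrite gt0_mulNye ?lte_fin.
Qed.

Lemma gamma_law_conv a s t (A : set R) : 0 < a -> 0 <= s -> 0 <= t ->
  measurable A ->
  ((gamma_law a s \x gamma_law a t) (plus_set A) = gamma_law a (s + t) A)%E.
Proof.
move=> a0; rewrite le_eqVlt => /predU1P[<-|s0].
  move=> _ mA; rewrite add0r /product_measure1/=.
  rewrite (eq_measure_integral \d_(0 : R)); last first.
    by move=> B _ _ /=; rewrite gamma_law0.
  rewrite integral_dirac//.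
    rewrite diracT mul1e /=; congr (gamma_law _ _ _).
    by apply/seteqP; split => y; rewrite /xsection /plus_set/= inE/= add0r.
  exact: measurable_fun_xsection (measurable_plus_set mA).
rewrite le_eqVlt => /predU1P[<- mA|t0]; last exact: gamma_law_conv_gt0.
rewrite addr0 /product_measure1/=.
transitivity (\int[gamma_law a s]_x (\1_A x)%:E)%E; last first.
  by rewrite integral_indic// setIT.
apply: eq_integral => x _; rewrite gamma_law0 /dirac indicE indicE.
by rewrite mem_xsection -[in RHS](addr0 x).
Qed.

End gamma_convolution.

(** * Independence of sums over disjoint index sets *)
Section independence.
Context {d : measure_display} {T : measurableType d} {R : realType}
  (P : probability T R).
Local Open Scope ereal_scope.

Lemma measurable_RV_preimage (X : {RV P >-> R}) (A : set R) :
  measurable A -> measurable (X @^-1` A).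
Proof. by move=> mA; rewrite -[X @^-1` A]setTI; exact: measurable_funPT. Qed.

(** Independence of [X] and [Y] on rectangles, both of them jointly with [E],
    extends to all measurable sets of pairs by uniqueness of product measures,
    applied to the restriction of [P] to [E]. *)
Lemma joint_law_on_event (d1 d2 : measure_display) (T1 : measurableType d1)
    (T2 : measurableType d2) (E : set T)
    (X : {RV P >-> T1}) (Y : {RV P >-> T2}) : measurable E ->
  (forall A B, measurable A -> measurable B ->
    P (E `&` (X @^-1` A `&` Y @^-1` B)) =
    P E * (P (X @^-1` A) * P (Y @^-1` B))) ->
  forall C : set (T1 * T2), measurable C ->
    P (E `&` [set w | C (X w, Y w)]) =
    P E * (distribution P X \x distribution P Y) C.
Proof.
move=> mE XYE C mC.
have PE0 : (0 <= fine (P E))%R by exact: fine_ge0.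
have PEE : (fine (P E))%:E = P E by rewrite fineK// fin_num_measure.
pose XY w : T1 * T2 := (X w, Y w).
have mXY : measurable_fun setT XY.
  apply: measurable_fun_pair => /=; first exact: (measurable_funPT X).
  exact: (measurable_funPT Y).
pose m : {measure set (T1 * T2) -> \bar R} :=
  measure_function_pushforward__canonical__measure_function_Measure
    (mrestr P mE) mXY.
pose k := NngNum PE0.
have -> : P (E `&` [set w | C (X w, Y w)]) = m C by rewrite setIC.
rewrite -(@product_measure_unique _ _ _ _ _
  (mscale k (distribution P X)) (distribution P Y) m)//.
  rewrite /product_measure1 ge0_integral_mscale//=; first by rewrite PEE.
  exact: measurable_fun_xsection.
move=> A B mA mB.
rewrite [RHS](_ : _ = (fine (P E))%:E * P (X @^-1` A) * P (Y @^-1` B))//.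
by rewrite PEE -muleA -XYE// setIC.
Qed.

Variables (I : finType) (Z : I -> {RV P >-> R}).
Hypothesis Zindep : mutually_independent Z.

Implicit Types (K J : {set I}) (B : I -> set R).

Let evt (K : {set I}) (B : I -> set R) : set T :=
  \bigcap_(i in [set` K]) (Z i @^-1` B i).

Let measurable_evt K B : (forall i, i \in K -> measurable (B i)) ->
  measurable (evt K B).
Proof.
move=> mB; apply: fin_bigcap_measurable => // i iK.
by apply: measurable_RV_preimage; exact: mB.
Qed.

Let evtU1 i K B : evt (i |: K) B = Z i @^-1` B i `&` evt K B.
Proof.
rewrite /evt (_ : [set` i |: K] = [set i] `|` [set` K])%classic.
  by rewrite bigcap_setU bigcap_set1.
by apply/seteqP; split => j /=; rewrite in_setU1 => /predU1P.
Qed.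

Let evt1 i B : evt [set i]%SET B = Z i @^-1` B i.
Proof.
rewrite /evt (_ : [set` [set i]%SET] = [set i])%classic ?bigcap_set1//.
by apply/seteqP; split => j /=; rewrite inE => /eqP.
Qed.

(** If [E] is independent of the family indexed by [J], then a sum over part of
    [J] is independent of [E] together with the variables of [J] outside the
    sum. Carrying the spare variables in the induction is what allows one of
    them to be added to the sum: [Z i] and the sum over [s] are independent on
    the event [E `&` evt K B], and [joint_law_on_event] passes to [Z i] plus the
    sum.
    The event [E] serves to treat a second, disjoint sum afterwards. *)
Lemma sum_indep_of_event J (s : seq I) (E : set T) : uniq s ->
  {subset s <= J} -> measurable E ->
  (forall K B, K \subset J ->
    (forall i, i \in K -> measurable (B i)) ->
    P (E `&` evt K B) = P E * \prod_(i in K) P (Z i @^-1` B i)) ->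
  forall K B (A : set R), K \subset J -> {in s, forall i, i \notin K} ->
    (forall i, i \in K -> measurable (B i)) -> measurable A ->
    P (E `&` evt K B `&` (\sum_(i <- s) Z i)%R @^-1` A) =
    P (E `&` evt K B) * P ((\sum_(i <- s) Z i)%R @^-1` A).
Proof.
elim: s E => [|i s IH] E /=.
  move=> _ _ mE HE K B A KJ _ mB mA; rewrite big_nil.
  have [A0|A0] := pselect (A 0%R).
    rewrite (_ : _ @^-1` A = setT); last by apply/seteqP; split.
    by rewrite setIT probability_setT mule1.
  rewrite (_ : _ @^-1` A = set0); last by apply/seteqP; split.
  by rewrite setI0 measure0 mule0.
move=> /andP[i_s us] isJ mE HE K B A KJ dK mB mA.
have iK : i \notin K by apply: dK; rewrite mem_head.
have iJ : i \in J by apply: isJ; rewrite mem_head.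
have sJ : {subset s <= J} by move=> j js; apply: isJ; rewrite in_cons js orbT.
have step (F : set T) (mF : measurable F)
    (HF : forall A1 A2 : set R, measurable A1 -> measurable A2 ->
      P (F `&` (Z i @^-1` A1 `&` (\sum_(i <- s) Z i)%R @^-1` A2)) =
      P F * (P (Z i @^-1` A1) * P ((\sum_(i <- s) Z i)%R @^-1` A2))) :
    P (F `&` (\sum_(j <- i :: s) Z j)%R @^-1` A) =
    P F *
    (distribution P (Z i) \x distribution P (\sum_(i <- s) Z i)%R) (plus_set A).
  rewrite -joint_law_on_event//; last exact: measurable_plus_set.
  by rewrite big_cons.
have HT (K' : {set I}) (B' : I -> set R) : K' \subset J ->
    (forall i, i \in K' -> measurable (B' i)) ->
    P (setT `&` evt K' B') = P setT * \prod_(i in K') P (Z i @^-1` B' i).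
  by move=> K'J mB'; rewrite setTI probability_setT mul1e; exact: Zindep.
have -> : P ((\sum_(j <- i :: s) Z j)%R @^-1` A) =
    (distribution P (Z i) \x distribution P (\sum_(i <- s) Z i)%R) (plus_set A).
  rewrite -[LHS](congr1 P (setTI _)) step//.
    by rewrite probability_setT mul1e.
  move=> A1 A2 mA1 mA2.
  have := IH setT us sJ measurableT HT [set i]%SET (fun=> A1) A2.
  rewrite evt1 !setTI probability_setT mul1e; apply => //.
  - by rewrite finset.sub1set.
  - by move=> j js; rewrite inE; apply: contraNneq i_s => <-.
apply: step; first by apply: measurableI => //; exact: measurable_evt.
move=> A1 A2 mA1 mA2.
(* The induction hypothesis for [i |: K] puts the constraint on [Z i] among
   those of the spare variables. *)
pose B' j := if j == i then A1 else B j.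
have B'K : evt K B' = evt K B.
  apply: eq_bigcapr => j /= jK; rewrite /B' ifN//.
  by apply: contraNneq iK => <-.
have e : evt (i |: K) B' = Z i @^-1` A1 `&` evt K B.
  by rewrite evtU1 B'K /B' eqxx.
have mB' j : j \in i |: K -> measurable (B' j).
  rewrite in_setU1 /B'; case: eqVneq => //= _; exact: mB.
have iKJ : i |: K \subset J by rewrite finset.subUset finset.sub1set iJ.
have := IH E us sJ mE HE (i |: K) B' A2 iKJ _ mB' mA2.
rewrite HE// big_setU1//= e => IH'.
rewrite [X in P X](_ : _ = E `&` (Z i @^-1` A1 `&` evt K B)
    `&` (\sum_(i <- s) Z i)%R @^-1` A2); last first.
  by rewrite !setIA; congr (_ `&` _); rewrite setIAC.
rewrite IH'; last first.
  move=> j js; rewrite in_setU1 negb_or; apply/andP; split.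
    by apply: contraNneq i_s => <-.
  by apply: dK; rewrite in_cons js orbT.
rewrite HE// /B' eqxx !muleA; congr (_ * _).
rewrite muleAC; congr (_ * _ * _).
by apply: eq_bigr => j jK; rewrite ifN//; apply: contraNneq iK => <-.
Qed.

Lemma law_of_disjoint_sums (s1 s2 : seq I) (C : set (R * R)) :
  uniq (s1 ++ s2) -> measurable C ->
  P [set w | C ((\sum_(i <- s1) Z i)%R w, (\sum_(i <- s2) Z i)%R w)] =
  (distribution P (\sum_(i <- s1) Z i)%R \x
   distribution P (\sum_(i <- s2) Z i)%R) C.
Proof.
rewrite cat_uniq => /and3P[us1 /hasPn s12 us2] mC.
rewrite -[LHS](congr1 P (setTI _)) joint_law_on_event//.
  by rewrite probability_setT mul1e.
move=> A B mA mB; rewrite setTI probability_setT mul1e.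
(* An event on the first sum is independent of the variables outside [s1]. *)
have E1 (K : {set I}) (B' : I -> set R) : {in s1, forall i, i \notin K} ->
    (forall i, i \in K -> measurable (B' i)) ->
    P ((\sum_(i <- s1) Z i)%R @^-1` A `&` evt K B') =
    P ((\sum_(i <- s1) Z i)%R @^-1` A) * \prod_(i in K) P (Z i @^-1` B' i).
  move=> s1K mB'; rewrite -[in RHS]Zindep// [RHS]muleC.
  rewrite -[in RHS](setTI (\bigcap_(i in [set` K]) _)).
  rewrite -(@sum_indep_of_event [set: I]%SET s1)//.
  - by rewrite setTI setIC.
  - by move=> i _; rewrite inE.
  - by move=> K0 B0 _ mB0; rewrite setTI probability_setT mul1e; exact: Zindep.
have evt0 B' : evt finset.set0 B' = setT.
  by apply/seteqP; split => // w _ i /=; rewrite inE.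
have := @sum_indep_of_event [set i | i \notin s1]%SET s2
  ((\sum_(i <- s1) Z i)%R @^-1` A) us2 _ (measurable_RV_preimage _ mA) _
  finset.set0 (fun=> setT) B.
rewrite evt0 setIT; apply => //.
- by move=> i /s12 is1; rewrite inE.
- move=> K B' /fintype.subsetP Ks1 mB'; apply: E1 => // i is1.
  by apply: contraL is1 => /Ks1; rewrite inE.
- exact: finset.sub0set.
- by move=> i _; rewrite inE.
Qed.

End independence.

(** * Products of mixtures *)
Section mixture.
Context {d1 d2 : measure_display} {T1 : measurableType d1}
  {T2 : measurableType d2} {R : realType}.
Local Open Scope ereal_scope.

(** By monotone convergence, both the measure of a section under [m2] and the
    integral against [m1] expand term by term. *)
Lemma product_mixture (m1 : probability T1 R) (m2 : probability T2 R)
    (mu : nat -> probability T1 R) (nu : nat -> probability T2 R)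
    (c e : nat -> R) : (forall k, (0 <= c k)%R) -> (forall k, (0 <= e k)%R) ->
  (forall A, measurable A -> m1 A = \sum_(0 <= k <oo) (c k)%:E * mu k A) ->
  (forall A, measurable A -> m2 A = \sum_(0 <= l <oo) (e l)%:E * nu l A) ->
  forall C, measurable C ->
  (m1 \x m2) C = \sum_(0 <= k <oo) \sum_(0 <= l <oo)
    (c k)%:E * (e l)%:E * (mu k \x nu l) C.
Proof.
move=> c0 e0 m1E m2E C mC.
have mx l := measurable_fun_xsection (nu l) mC.
rewrite {1}/product_measure1.
rewrite (eq_measure_integral
  (mseries (fun k => mscale (NngNum (c0 k)) (mu k)) 0)); last first.
  by move=> A mA _; exact: m1E.
rewrite ge0_integral_measure_series//; last first.
  exact: measurable_fun_xsection.
apply: eq_eseriesr => k _; rewrite ge0_integral_mscale//=; last first.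
  exact: measurable_fun_xsection.
under eq_integral => x _ do rewrite (m2E _ (measurable_xsection x mC)).
rewrite integral_nneseries//; last 2 first.
- by move=> l; apply: emeasurable_funM => //; exact: mx.
- by move=> l x _; rewrite mule_ge0// lee_fin.
rewrite -nneseriesZl//; last first.
  by move=> l _; apply: integral_ge0 => x _; rewrite mule_ge0// lee_fin.
apply: eq_eseriesr => l _; rewrite -muleA; congr *%E.
rewrite ge0_integralZl//; [exact: mx|by rewrite lee_fin].
Qed.

End mixture.

Section cauchy_product.
Context {R : realType}.
Local Open Scope ereal_scope.

(** The inner series of index [k] is shifted by [k] and padded with zeros, after
    which the two summations can be exchanged. *)
Lemma nneseries_antidiagonal (F : nat -> nat -> \bar R) :
  (forall k l, 0 <= F k l) ->
  \sum_(0 <= k <oo) \sum_(0 <= l <oo) F k l =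
  \sum_(0 <= m <oo) \sum_(k < m.+1) F k (m - k)%N.
Proof.
move=> F0; pose G k m := if (k <= m)%N then F k (m - k)%N else 0.
have G0 k m : 0 <= G k m by rewrite /G; case: ifP.
transitivity (\sum_(0 <= k <oo) \sum_(0 <= m <oo) G k m).
  apply: eq_eseriesr => k _.
  rewrite [RHS](@nneseries_split _ _ 0 k)// add0n.
  rewrite big_nat big1 ?add0e; last first.
    by move=> m /andP[_ mk]; rewrite /G leqNgt mk.
  rewrite -[RHS]nneseries_addn//; apply: eq_eseriesr => l _.
  by rewrite /G leq_addl addnK.
rewrite nneseries_interchange//; apply: eq_eseriesr => m _.
rewrite (@nneseries_split _ _ 0 m.+1)// add0n eseries0 ?adde0; last first.
  by move=> k mk _; rewrite /G leqNgt mk.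
rewrite big_mkord; apply: eq_bigr => k _.
by rewrite /G -ltnS ltn_ord.
Qed.

End cauchy_product.

(** * Sums of independent gamma variables *)
Section sums_of_gammas.
Context {R : realType} (I : finType) (r p : I -> R).
Implicit Types s : seq I.

(** The convolution of the distributions [negbin_pmf (p i) (r i)] for [i] in
    [s], by [nbsum_pmf_cons]. *)
Definition nbsum_pmf s (k : nat) : R :=
  (\prod_(i <- s) r i `^ p i) *
  rec_coef (fun m => m%:R^-1 * \sum_(i <- s) p i * (1 - r i) ^+ m) k.

Lemma nbsum_pmf_nil k : nbsum_pmf [::] k = (k == 0%N)%:R.
Proof.
rewrite /nbsum_pmf big_nil mul1r -rec_coef_zero.
by apply: rec_coef_eq => i _; rewrite big_nil mulr0.
Qed.

Lemma nbsum_pmf_cons i s k :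
  nbsum_pmf (i :: s) k =
  \sum_(j < k.+1) negbin_pmf (p i) (r i) j * nbsum_pmf s (k - j)%N.
Proof.
rewrite /nbsum_pmf /negbin_pmf big_cons.
under [RHS]eq_bigr do rewrite mulrACA.
rewrite -mulr_sumr rec_coefD; congr (_ * _); apply: rec_coef_eq => m _.
by rewrite big_cons mulrDr.
Qed.

Hypothesis p_gt0 : forall i, 0 < p i.
Hypothesis r01 : forall i, 0 < r i <= 1.

Lemma nbsum_pmf_ge0 s k : 0 <= nbsum_pmf s k.
Proof.
rewrite /nbsum_pmf mulr_ge0//.
  by apply: prodr_ge0 => i _; exact: powR_ge0.
apply: rec_coef_ge0 => m _; rewrite mulr_ge0 ?invr_ge0//.
apply: sumr_ge0 => i _; have /andP[r0 r1] := r01 i.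
by rewrite mulr_ge0 ?(ltW (p_gt0 i))// exprn_ge0// subr_ge0.
Qed.

Section law.
Context {d : measure_display} {T : measurableType d} (P : probability T R)
  (Z : I -> {RV P >-> R}) (a : R).
Hypothesis a_gt0 : 0 < a.
Hypothesis Zindep : mutually_independent Z.
Local Open Scope ereal_scope.

Let gamma_on s :=
  forall i, i \in s -> has_law P (Z i) (gamma_law (r i * a) (p i)).

(** Induction on [s]. The expansions of the law of [Z i] and of the law of the
    remaining sum are multiplied out; [gamma_law_conv] merges the gamma laws
    into one that depends on the two indices only through their sum, and summing
    over antidiagonals convolves the weights. *)
Lemma law_sum_gamma s (A : set R) : uniq s -> gamma_on s -> measurable A ->
  P ((\sum_(i <- s) Z i)%R @^-1` A) =
  \sum_(0 <= k <oo)
    (nbsum_pmf s k)%:E * gamma_law a (\sum_(i <- s) p i + k%:R)%R A.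
Proof.
elim: s A => [|i s IH] A /=.
  move=> _ _ mA; rewrite !big_nil (@nneseries_split _ _ 0 1)//; last first.
    by move=> k _; rewrite mule_ge0// lee_fin nbsum_pmf_ge0.
  rewrite add0n big_nat1 eseries0 ?adde0; last first.
    by move=> [//|k] _ _; rewrite nbsum_pmf_nil mul0e.
  rewrite nbsum_pmf_nil mul1e addr0 gamma_law0 diracE.
  have [A0|A0] := pselect (A 0%R).
    rewrite (_ : _ @^-1` A = setT); first by rewrite probability_setT mem_set.
    by apply/seteqP; split.
  rewrite (_ : _ @^-1` A = set0); first by rewrite measure0 memNset.
  by apply/seteqP; split.
move=> /andP[i_s us] ZE mA.
have -> : (\sum_(j <- i :: s) Z j)%R @^-1` A =
    [set w | plus_set A
      ((\sum_(j <- [:: i]) Z j)%R w, (\sum_(j <- s) Z j)%R w)].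
  by rewrite big_cons big_seq1.
rewrite law_of_disjoint_sums//; last 2 first.
- by rewrite /= i_s.
- exact: measurable_plus_set.
rewrite big_seq1.
rewrite (@product_mixture _ _ _ _ _ _ _
  (fun k => gamma_law a (p i + k%:R))
  (fun l => gamma_law a (\sum_(j <- s) p j + l%:R))
  (negbin_pmf (p i) (r i)) (nbsum_pmf s))//; last 5 first.
- by move=> k; exact: negbin_pmf_ge0.
- exact: nbsum_pmf_ge0.
- by move=> B mB; rewrite [LHS]ZE ?mem_head// gamma_law_negbin.
- move=> B mB; apply: IH => // j js; apply: ZE.
  by rewrite in_cons js orbT.
- exact: measurable_plus_set.
have ps0 : (0 <= \sum_(j <- s) p j)%R by apply: sumr_ge0 => j _; exact: ltW.
have conv k l := gamma_law_conv a_gt0 (addr_ge0 (ltW (p_gt0 i)) (ler0n R k))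
  (addr_ge0 ps0 (ler0n R l)) mA.
under eq_eseriesr => k _ do under eq_eseriesr => l _ do rewrite conv.
rewrite nneseries_antidiagonal; last first.
  by move=> k l; rewrite !mule_ge0// lee_fin ?negbin_pmf_ge0 ?nbsum_pmf_ge0.
apply: eq_eseriesr => m _.
rewrite nbsum_pmf_cons -sumEFin ge0_sume_distrl; last first.
  by move=> j _; rewrite lee_fin mulr_ge0 ?negbin_pmf_ge0 ?nbsum_pmf_ge0.
apply: eq_bigr => j _; rewrite EFinM big_cons; congr (_ * gamma_law _ _ _).
by rewrite natrB; [ring|rewrite -ltnS].
Qed.

(** The weights are summed by evaluating probability measures on the whole
    line. *)
Lemma nbsum_pmf_total s : uniq s -> gamma_on s ->
  \sum_(0 <= k <oo) (nbsum_pmf s k)%:E = 1.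
Proof.
move=> us ZE; have := law_sum_gamma us ZE measurableT.
rewrite preimage_setT probability_setT => ->; apply: eq_eseriesr => k _.
by rewrite probability_setT mule1.
Qed.

End law.
End sums_of_gammas.

(** * Independent variables with given distributions on the integers *)
Section discrete_law.
Context {R : realType} (f : nat -> R).
Hypotheses (f0 : forall k, 0 <= f k).
Local Open Scope ereal_scope.
Hypothesis f1 : \sum_(0 <= k <oo) (f k)%:E = 1.

Let discrete_law : set nat -> \bar R :=
  mseries (fun k => mscale (NngNum (f0 k)) \d_k) 0.

Let discrete_lawE A : discrete_law A = \sum_(0 <= k <oo) (f k)%:E * \d_k A.
Proof. by []. Qed.

HB.instance Definition _ := Measure.on discrete_law.

Let discrete_law_setT : discrete_law setT = 1.
Proof.
by rewrite discrete_lawE -f1; apply: eq_eseriesr => k _; rewrite diracT mule1.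
Qed.

HB.instance Definition _ :=
  Measure_isProbability.Build _ _ _ discrete_law discrete_law_setT.

Lemma exists_discrete_probability :
  exists Q : probability nat R, forall k, Q [set k] = (f k)%:E.
Proof.
exists discrete_law => k.
rewrite [LHS]discrete_lawE (@nneseriesD1 _ _ k xpredT)//.
  rewrite diracE mem_set// mule1 eseries0 ?adde0// => l _ lk.
  by rewrite diracE memNset ?mule0//= => /esym kl; rewrite kl eqxx in lk.
by move=> l _; rewrite mule_ge0// lee_fin.
Qed.

End discrete_law.

Section independent_pair.
Context {R : realType}.
Local Open Scope ereal_scope.

Lemma mutually_independent_pair (d : measure_display) (T : measurableType d)
    (Q : probability T R) (L M : {RV Q >-> nat}) :
  (forall A B : set nat,
    Q (L @^-1` A `&` M @^-1` B) = Q (L @^-1` A) * Q (M @^-1` B)) ->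
  mutually_independent (fun b : bool => if b then L else M).
Proof.
move=> LM J B _.
pose B' (b : bool) := if b \in J then B b else setT.
rewrite (_ : \bigcap_(i in _) _ = L @^-1` B' true `&` M @^-1` B' false).
  rewrite LM big_mkcond big_bool/= /B'.
  by congr *%E; case: ifP => // _; rewrite preimage_setT probability_setT.
apply/seteqP; split => w /=.
  by move=> h; split; rewrite /B' /=; case: ifP => // bJ; exact: (h _ bJ).
by rewrite /B' => -[hL hM] [] /= bJ; rewrite bJ in hL hM.
Qed.

Lemma exists_independent_pair (f g : nat -> R) :
  (forall k, (0 <= f k)%R) -> \sum_(0 <= k <oo) (f k)%:E = 1 ->
  (forall k, (0 <= g k)%R) -> \sum_(0 <= k <oo) (g k)%:E = 1 ->
  exists (d : measure_display) (T : measurableType d) (Q : probability T R)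
    (L M : {RV Q >-> nat}),
    [/\ mutually_independent (fun b : bool => if b then L else M),
        forall k, Q (L @^-1` [set k]) = (f k)%:E &
        forall k, Q (M @^-1` [set k]) = (g k)%:E].
Proof.
move=> f0 f1 g0 g1.
have [Q1 Q1E] := exists_discrete_probability f0 f1.
have [Q2 Q2E] := exists_discrete_probability g0 g1.
pose Q : probability (nat * nat)%type R := (Q1 \x Q2).
pose L : {RV Q >-> nat} := HB.pack (fst : nat * nat -> nat)
  (isMeasurableFun.Build _ _ _ _ _ (measurable_fst)).
pose M : {RV Q >-> nat} := HB.pack (snd : nat * nat -> nat)
  (isMeasurableFun.Build _ _ _ _ _ (measurable_snd)).
have QE (A B : set nat) : Q (L @^-1` A `&` M @^-1` B) = Q1 A * Q2 B.
  by rewrite -product_measure1E.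
have QL A : Q (L @^-1` A) = Q1 A.
  by rewrite -[L @^-1` A]setIT -(preimage_setT M) QE probability_setT mule1.
have QM B : Q (M @^-1` B) = Q2 B.
  by rewrite -[M @^-1` B]setTI -(preimage_setT L) QE probability_setT mul1e.
exists _, _, Q, L, M; split => [|k|k]; [|by rewrite QL|by rewrite QM].
by apply: mutually_independent_pair => A B; rewrite QE QL QM.
Qed.

End independent_pair.

(** * The scale ratios *)
Section scale_ratios.
Context {R : realType} (n : nat) (alpha w : 'I_n -> R).
Hypotheses (n_gt0 : (0 < n)%N) (alpha_gt0 : forall j, 0 < alpha j)
  (w_gt0 : forall j, 0 < w j).
Let m := max_ratio alpha w.

Lemma max_ratio_gt0 : 0 < m.
Proof.
pose j := Ordinal n_gt0.
apply: (@lt_le_trans _ _ (alpha j / (w j + alpha j))).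
  by rewrite divr_gt0 ?addr_gt0.
by rewrite /m /max_ratio (le_bigmax_cond _ (P := xpredT)).
Qed.

Lemma max_ratio_lt1 : m < 1.
Proof.
apply: bigmax_lt => // j _.
by rewrite ltr_pdivrMr ?addr_gt0// mul1r ltrDr.
Qed.

Lemma scale_ratio_itv j : 0 < scale_ratio alpha w j <= 1.
Proof.
have m0 := max_ratio_gt0; have m1 := max_ratio_lt1.
have aj := alpha_gt0 j; have wj := w_gt0 j.
apply/andP; split; first by rewrite divr_gt0 ?mulr_gt0 ?subr_gt0.
rewrite ler_pdivrMr ?mulr_gt0// mul1r -/m.
have : alpha j / (w j + alpha j) <= m.
  by rewrite /m /max_ratio (le_bigmax_cond _ (P := xpredT)).
by rewrite ler_pdivrMr ?addr_gt0//; nra.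
Qed.

(** Since [t |-> t / (1 + t)] increases, [m / (1 - m)] is the largest of the
    rates [alpha j / w j], and [scale_ratio] is the quotient by it. *)
Lemma scale_ratio_mul_rate j :
  scale_ratio alpha w j * (m / (1 - m)) = alpha j / w j.
Proof.
have m0 := max_ratio_gt0; have m1 := max_ratio_lt1.
rewrite /scale_ratio -/m; field.
by rewrite !gt_eqF// subr_gt0.
Qed.

Lemma odds_max_ratio_gt0 : 0 < m / (1 - m).
Proof. by rewrite divr_gt0 ?max_ratio_gt0// subr_gt0 max_ratio_lt1. Qed.

End scale_ratios.

(** * The weighted difference of two gamma sums *)
Theorem theorem3p1 (R : realType) (d : measure_display)
    (Omega : measurableType d) (P : probability Omega R)
    (n : nat) (hn : (1 <= n)%N)
    (alpha_ p_ beta_ q_ w1 w2 : 'I_n -> R)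
    (halpha : forall j, 0 < alpha_ j) (hp : forall j, 0 < p_ j)
    (hbeta : forall j, 0 < beta_ j) (hq : forall j, 0 < q_ j)
    (hw1 : forall j, 0 < w1 j) (hw2 : forall j, 0 < w2 j)
    (X Y : 'I_n -> {RV P >-> R})
    (hindep : mutually_independent
       (fun k : 'I_n + 'I_n => match k with inl j => X j | inr j => Y j end))
    (hX : forall j, has_law P (X j) (gamma_prob (alpha_ j) (p_ j)))
    (hY : forall j, has_law P (Y j) (gamma_prob (beta_ j) (q_ j))) :
  let Tn : Omega -> R :=
    fun omega => \sum_(j < n) (w1 j * X j omega - w2 j * Y j omega) in
  let p := \sum_(j < n) p_ j in
  let q := \sum_(j < n) q_ j in
  let alpha := max_ratio alpha_ w1 in
  let beta := max_ratio beta_ w2 in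
  let spec (d' : measure_display) (Omega' : measurableType d')
      (Q : probability Omega' R) (Ln Mn : {RV Q >-> nat}) : Prop :=
    [/\ mutually_independent (fun b : bool => if b then Ln else Mn),
        forall k : nat,
          Q (Ln @^-1` [set k]) = (mix_pmf alpha_ p_ w1 k)%:E &
        forall k : nat,
          Q (Mn @^-1` [set k]) = (mix_pmf beta_ q_ w2 k)%:E] in
  (exists (d' : measure_display) (Omega' : measurableType d')
      (Q : probability Omega' R) (Ln Mn : {RV Q >-> nat}),
      spec d' Omega' Q Ln Mn) /\
  (forall (d' : measure_display) (Omega' : measurableType d')
      (Q : probability Omega' R) (Ln Mn : {RV Q >-> nat}),
      spec d' Omega' Q Ln Mn ->
      has_law P Tn
        (bilateral_gamma_mixture (alpha / (1 - alpha)) Ln p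
                                 (beta / (1 - beta)) Mn q)).
Proof.
move=> Tn p q alpha beta spec.
(* The two families are handled together, indexed by ['I_n + 'I_n]. *)
pose w k := match k with inl j => w1 j | inr j => w2 j end.
pose XY k : {RV P >-> R} := match k with inl j => X j | inr j => Y j end.
pose Z (k : 'I_n + 'I_n) : {RV P >-> R} := scale_mfun (w k) (XY k).
pose r k := match k with
  inl j => scale_ratio alpha_ w1 j | inr j => scale_ratio beta_ w2 j end.
pose s k := match k with inl j => p_ j | inr j => q_ j end.
pose c k := match k with inl j => alpha_ j | inr j => beta_ j end.
have w0 k : 0 < w k by case: k => j; [exact: hw1|exact: hw2].
have s0 k : 0 < s k by case: k => j; [exact: hp|exact: hq].
have c0 k : 0 < c k by case: k => j; [exact: halpha|exact: hbeta].
have r01 k : 0 < r k <= 1 by case: k => j; exact: scale_ratio_itv.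
have Zindep : mutually_independent Z.
  move=> J B mB.
  rewrite -(hindep J (fun k => [set x | B k (x * w k)]))//.
  move=> k kJ; rewrite -[X in measurable X]setTI.
  exact: (mulrr_measurable (w k) measurableT (mB k kJ)).
have Zlaw k : has_law P (Z k) (gamma_law (c k / w k) (s k)).
  move=> A mA; rewrite -gamma_law_scale// gamma_lawE//.
  transitivity (P (XY k @^-1` [set x | A (w k * x)])).
    by congr (P _); apply/seteqP; split => x /=; rewrite mulrC.
  have mA' : measurable [set x : R | A (w k * x)].
    rewrite -[X in measurable X]setTI.
    exact: (mulrl_measurable (w k) measurableT mA).
  by case: k mA' => j mA'; [rewrite -hX|rewrite -hY].
pose s1 : seq ('I_n + 'I_n) := [seq inl j | j <- index_enum 'I_n].
pose s2 : seq ('I_n + 'I_n) := [seq inr j | j <- index_enum 'I_n].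
have us1 : uniq s1 by rewrite map_inj_uniq ?index_enum_uniq// => ? ? [].
have us2 : uniq s2 by rewrite map_inj_uniq ?index_enum_uniq// => ? ? [].
have us12 : uniq (s1 ++ s2).
  rewrite cat_uniq us1 us2 andbT; apply/hasPn => _ /mapP[j _ ->].
  by apply/mapP => -[].
have Z1 k : k \in s1 ->
    has_law P (Z k) (gamma_law (r k * (alpha / (1 - alpha))) (s k)).
  move=> /mapP[j _ ->].
  by rewrite scale_ratio_mul_rate//; exact: (Zlaw (inl j)).
have Z2 k : k \in s2 ->
    has_law P (Z k) (gamma_law (r k * (beta / (1 - beta))) (s k)).
  move=> /mapP[j _ ->].
  by rewrite scale_ratio_mul_rate//; exact: (Zlaw (inr j)).
have a0 : 0 < alpha / (1 - alpha) by exact: odds_max_ratio_gt0.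
have b0 : 0 < beta / (1 - beta) by exact: odds_max_ratio_gt0.
have pmf1 k : nbsum_pmf r s s1 k = mix_pmf alpha_ p_ w1 k.
  rewrite /nbsum_pmf /mix_pmf /mix_const /mix_exponent big_map; congr (_ * _).
  by apply: rec_coef_eq => i _; rewrite big_map.
have pmf2 k : nbsum_pmf r s s2 k = mix_pmf beta_ q_ w2 k.
  rewrite /nbsum_pmf /mix_pmf /mix_const /mix_exponent big_map; congr (_ * _).
  by apply: rec_coef_eq => i _; rewrite big_map.
split.
  apply: exists_independent_pair.
  - by move=> k; rewrite -pmf1; exact: nbsum_pmf_ge0.
  - under eq_eseriesr do rewrite -pmf1.
    exact: (nbsum_pmf_total s0 r01 a0 Zindep us1 Z1).
  - by move=> k; rewrite -pmf2; exact: nbsum_pmf_ge0.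
  - under eq_eseriesr do rewrite -pmf2.
    exact: (nbsum_pmf_total s0 r01 b0 Zindep us2 Z2).
move=> d' Omega' Q Ln Mn [_ LnE MnE] A mA.
pose C : set (R * R) := [set z | A (z.1 - z.2)].
have mC : measurable C.
  rewrite -[C]setTI.
  have mB : measurable_fun [set: R * R] (fun z : R * R => z.1 - z.2).
    by apply: measurable_funB; [exact: measurable_fst|exact: measurable_snd].
  exact: mB.
have -> : pushforward P Tn A =
    P [set x | C ((\sum_(k <- s1) Z k) x, (\sum_(k <- s2) Z k) x)].
  congr (P _); apply/seteqP.
  suff E x : Tn x = (\sum_(k <- s1) Z k) x - (\sum_(k <- s2) Z k) x.
    by split => x; rewrite /C /= E.
  rewrite !big_map !mfun_sum -sumrB /Tn; apply: eq_bigr => j _.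
  by rewrite /= [w1 j * _]mulrC [w2 j * _]mulrC.
rewrite (law_of_disjoint_sums Zindep us12 mC).
rewrite (@product_mixture _ _ _ _ _ _ _
  (fun k => gamma_law (alpha / (1 - alpha)) (p + k%:R))
  (fun l => gamma_law (beta / (1 - beta)) (q + l%:R))
  (mix_pmf alpha_ p_ w1) (mix_pmf beta_ q_ w2))//; last 4 first.
- by move=> k; rewrite -pmf1; exact: nbsum_pmf_ge0.
- by move=> k; rewrite -pmf2; exact: nbsum_pmf_ge0.
- move=> B mB; rewrite [LHS](law_sum_gamma s0 r01 a0 Zindep us1 Z1 mB) big_map.
  by apply: eq_eseriesr => k _; rewrite pmf1.
- move=> B mB; rewrite [LHS](law_sum_gamma s0 r01 b0 Zindep us2 Z2 mB) big_map.
  by apply: eq_eseriesr => k _; rewrite pmf2.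
have sum_gt0 (f : 'I_n -> R) : (forall j, 0 < f j) -> 0 < \sum_(j < n) f j.
  move=> f0; rewrite (bigD1 (Ordinal hn))//= ltr_pwDl//.
  by apply: sumr_ge0 => j _; exact: ltW.
have p0 : 0 < p by exact: sum_gt0.
have q0 : 0 < q by exact: sum_gt0.
apply: eq_eseriesr => k _; apply: eq_eseriesr => l _.
rewrite LnE MnE /bilateral_gamma_prob /pushforward.
rewrite -(gamma_lawE a0 (ltr_pwDl p0 (ler0n R k))).
by rewrite -(gamma_lawE b0 (ltr_pwDl q0 (ler0n R l))).
Qed.
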